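(* Let $R>0$, let $w$ be a pseudo-definite weight function on the disc $D_R$, let $N\ge1$, $M\ge1$, $K\ge0$, $D\ge1$ be integers, and let $f\in C^{2D+1}(\overline{D_R})$. Then $$\left|I^{\mathrm{poly}}_{(N,\infty,K)}(f)-I^{\mathrm{poly}}_{(N,M,K)}(f)\right|\le\frac{2\pi\,\zeta(2D+1)}{M^{2D+1}}\sum_{k=0}^{K}\sum_{\ell=1}^{a_k}M_{k,\ell}(f)\int_0^R|w_{(k,\ell)}(r)|\,r\,dr,$$ where $$M_{k,\ell}(f):=\sup_{r\in[0,R]}\ \sup_{\varphi\in[0,2\pi]}\left|\frac{d^{2D+1}}{d\varphi^{2D+1}}\left[f(re^{i\varphi})\,Y_{(k,\ell)}(\varphi)\right]\right|$$ and $\zeta$ denotes the Riemann zeta function.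
   Context: Points of the plane are written $re^{i\varphi}=(r\cos\varphi,r\sin\varphi)$; $D_R=\{x^2+y^2<R^2\}$. Put $a_0=1$, $a_k=2$ for $k\ge1$, $Y_{(0,1)}(\varphi)=1/\sqrt{2\pi}$, and for $k\ge1$: $Y_{(k,1)}(\varphi)=\frac1{\sqrt\pi}\cos k\varphi$, $Y_{(k,2)}(\varphi)=\frac1{\sqrt\pi}\sin k\varphi$. The Fourier coefficients of a function $f$ are $f_{(k,\ell)}(r)=\int_0^{2\pi}f(re^{i\varphi})Y_{(k,\ell)}(\varphi)\,d\varphi$, and similarly $w_{(k,\ell)}(r)$ for $w$, $0<r<R$. The weight $w$ is a real-valued function on $D_R$ (not necessarily non-negative), continuous except possibly at $0$. It is called pseudo-definite if for each $(k,\ell)$ either $w_{(k,\ell)}(r)\ge0$ for all $r\in(0,R)$ or $w_{(k,\ell)}(r)\le0$ for all $r\in(0,R)$. Standing assumption: each $w_{(k,\ell)}$ is continuous on $(0,R)$ and $\int_0^R|w_{(k,\ell)}(r)|\,r\,dr<\infty$. For each $(k,\ell)$ with $w_{(k,\ell)}\not\equiv0$, the numbers $t_{1,(k,\ell)}<\dots<t_{N,(k,\ell)}$ in $(0,R^2)$ and $\lambda_{1,(k,\ell)},\dots,\lambda_{N,(k,\ell)}$ (all of the same sign) are the nodes and weights of the $N$-point Gauss quadrature determined by $$\sum_{j=1}^N\lambda_{j,(k,\ell)}t_{j,(k,\ell)}^{s}=\frac12\int_0^{R^2}\rho^s\,\rho^{k/2}w_{(k,\ell)}(\sqrt\rho)\,d\rho\qquad(0\le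 s\le 2N-1).$$ If $w_{(k,\ell)}\equiv0$, set all $\lambda_{j,(k,\ell)}=0$ (with arbitrary nodes in $(0,R^2)$). Define the discretized Fourier coefficient $$f^{(M)}_{(k,\ell)}(r)=\frac{2\pi}{M}\sum_{s=1}^{M}f\!\left(re^{2\pi i s/M}\right)Y_{(k,\ell)}\!\left(\tfrac{2\pi s}{M}\right),$$ and $$I^{\mathrm{poly}}_{(N,M,K)}(f)=\frac12\sum_{k=0}^{K}\sum_{\ell=1}^{a_k}\sum_{j=1}^{N}\lambda_{j,(k,\ell)}\,t_{j,(k,\ell)}^{-k/2}\,f^{(M)}_{(k,\ell)}\!\left(\sqrt{t_{j,(k,\ell)}}\right),$$ $$I^{\mathrm{poly}}_{(N,\infty,K)}(f)=\frac12\sum_{k=0}^{K}\sum_{\ell=1}^{a_k}\sum_{j=1}^{N}\lambda_{j,(k,\ell)}\,t_{j,(k,\ell)}^{-k/2}\,f_{(k,\ell)}\!\left(\sqrt{t_{j,(k,\ell)}}\right).$$ *)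

(* Defs.v *)
From HB Require Import structures.
From mathcomp Require Import all_boot all_order all_algebra.
From mathcomp Require Import all_classical all_reals all_analysis.

Set Implicit Arguments.
Unset Strict Implicit.
Unset Printing Implicit Defensive.

Import Order.TTheory GRing.Theory Num.Theory.
Import numFieldNormedType.Exports.

Local Open Scope classical_set_scope.
Local Open Scope ring_scope.

Section Disc.
Context {R : realType}.
Implicit Types (rad r phi : R) (f w : R * R -> R) (k l : nat).

Definition polar r phi : R * R := (r * cos phi, r * sin phi).

Definition disc rad : set (R * R) :=
  [set p | p.1 ^+ 2 + p.2 ^+ 2 < rad ^+ 2].

Definition cdisc rad : set (R * R) :=
  [set p | p.1 ^+ 2 + p.2 ^+ 2 <= rad ^+ 2].

(* Every iterated partial derivative of [f] of order at most [m] exists on the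
   open disc and extends continuously to the closed disc.  Outside the open
   disc the values of the total functions ['D_v f] are meaningless, whence the
   existentially quantified extension [g]. *)
Fixpoint partials_extend rad (m : nat) f : Prop :=
  (exists g : R * R -> R,
     {within cdisc rad, continuous g} /\ {in disc rad, f =1 g}) /\
  if m is m'.+1 then
    (forall p, disc rad p -> derivable f p (1, 0) /\ derivable f p (0, 1)) /\
    partials_extend rad m' ('D_(1, 0) f) /\
    partials_extend rad m' ('D_(0, 1) f)
  else True.

(* [f] is in C^m of the closed disc; the first conjunct says that the values of
   [f] on the boundary circle are those of its continuous extension. *)
Definition Cm_cdisc rad (m : nat) f : Prop :=
  {within cdisc rad, continuous f} /\ partials_extend rad m f.

(* The admissible indices are the pairs (k, l) with 1 <= l <= mult k. *)
Definition mult k : nat := if k is 0%N then 1%N else 2%N.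

Definition valid_index k l : Prop := (1 <= l <= mult k)%N.

Definition Y k l phi : R :=
  if k is 0%N then 1 / Num.sqrt (2 * pi)
  else if l == 1%N then 1 / Num.sqrt pi * cos (k%:R * phi)
  else 1 / Num.sqrt pi * sin (k%:R * phi).

Definition fourier_coef f k l r : R :=
  (\int[@lebesgue_measure R]_(phi in `[0, 2 * pi])
      (f (polar r phi) * Y k l phi))%R.

Definition discrete_fourier_coef (M : nat) f k l r : R :=
  2 * pi / M%:R *
  \sum_(1 <= s < M.+1)
     f (polar r (2 * pi * s%:R / M%:R)) * Y k l (2 * pi * s%:R / M%:R).

Definition weight_continuous rad w : Prop :=
  forall p, disc rad p -> p != (0, 0) -> {for p, continuous w}.

Definition pseudo_definite rad w : Prop :=
  forall k l, valid_index k l ->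
    (forall r, 0 < r < rad -> 0 <= fourier_coef w k l r) \/
    (forall r, 0 < r < rad -> fourier_coef w k l r <= 0).

Definition weight_regular rad w : Prop :=
  forall k l, valid_index k l ->
    (forall r, 0 < r < rad -> {for r, continuous (fourier_coef w k l)}) /\
    (@lebesgue_measure R).-integrable `]0, rad[
       (fun r => (`|fourier_coef w k l r| * r)%:E).

Definition gauss_rule rad w (N k l : nat) (t lambda : 'I_N -> R) : Prop :=
  [/\ forall j, 0 < t j < rad ^+ 2,
      forall i j : 'I_N, (i < j)%N -> t i < t j,
      (forall j, 0 < lambda j) \/ (forall j, lambda j < 0) &
      forall s : nat, (s <= 2 * N - 1)%N ->
        \sum_(j < N) lambda j * t j ^+ s =
        1 / 2 * (\int[@lebesgue_measure R]_(rho in `]0, rad ^+ 2[)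
          (rho ^+ s * (rho `^ (k%:R / 2) *
             fourier_coef w k l (Num.sqrt rho))))%R].

Definition gauss_data rad w (N : nat) (t lambda : nat -> nat -> 'I_N -> R) :
    Prop :=
  forall k l, valid_index k l ->
    ((exists2 r, 0 < r < rad & fourier_coef w k l r != 0) ->
       gauss_rule rad w k l (t k l) (lambda k l)) /\
    ((forall r, 0 < r < rad -> fourier_coef w k l r = 0) ->
       forall j, 0 < t k l j < rad ^+ 2 /\ lambda k l j = 0).

(* The cubature sum, for a given family [c] of (exact or discretized) Fourier
   coefficients of the integrand. *)
Definition cubature_sum (N K : nat) (t lambda : nat -> nat -> 'I_N -> R)
    (c : nat -> nat -> R -> R) : R :=
  1 / 2 * \sum_(0 <= k < K.+1) \sum_(1 <= l < (mult k).+1) \sum_(j < N)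
     lambda k l j * t k l j `^ (- (k%:R / 2)) * c k l (Num.sqrt (t k l j)).

Definition I_poly (N M K : nat) (t lambda : nat -> nat -> 'I_N -> R) f : R :=
  cubature_sum K t lambda (discrete_fourier_coef M f).

Definition I_poly_infty (N K : nat) (t lambda : nat -> nat -> 'I_N -> R) f : R :=
  cubature_sum K t lambda (fourier_coef f).

Definition angular_bound rad (m k l : nat) f : R :=
  sup [set sup [set `|derive1n m (fun x : R => f (polar r x) * Y k l x) phi|
               | phi in `[0, 2 * pi]]
      | r in `[0, rad]].

Definition zeta (s : nat) : R :=
  limn (series (fun n : nat => (1 / n.+1%:R ^+ s : R))).

End Disc.

(* Main.v *)
Require Import Defs.
From HB Require Import structures.
From mathcomp Require Import all_boot all_order all_algebra.
From mathcomp Require Import all_classical all_reals all_analysis.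
From mathcomp Require Import measurable_realfun ring lra.

(* The difference of the two cubature sums is controlled by two estimates.

   Angular error.  For a function g of period 2 pi, averaging g over its
   translates by the M nodes and rescaling gives a 2 pi-periodic u with the same
   integral, with u(0) the node average of g and |u^(m)| <= sup |g^(m)| / M^m.
   Wirtinger's inequality for periodic functions of mean zero bounds the L^2
   norm of u' by that of u^(m), and integrating (x - pi) u' by parts gives
   |2 pi u(0) - int u| <= 4 pi sup |u^(m)|, because pi^2 <= 12.  As
   zeta(m) >= 1, no Fourier series is needed.

   Gauss weights.  The polynomial of degree < 2N interpolating x^(-k/2) to
   second order at the nodes stays below x^(-k/2), so positivity of the weights
   and exactness of the rule give
   sum_j |lambda_j| t_j^(-k/2) <= 1/2 int |w_kl(sqrt rho)| d rho
                                = int |w_kl(r)| r dr. *)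

Set Implicit Arguments.
Unset Strict Implicit.
Unset Printing Implicit Defensive.

Import Order.TTheory GRing.Theory Num.Theory.
Import numFieldNormedType.Exports.

Local Open Scope classical_set_scope.
Local Open Scope ring_scope.

(** * Derivatives and primitives *)

Section derive_fun.
Context {R : realType}.
Implicit Types (f g : R -> R) (x a b : R).

Lemma is_derive_const a x : is_derive x 1 (fun=> a) (0 : R).
Proof. exact: is_derive_cst. Qed.

Lemma is_derive_var x : is_derive x 1 (fun y : R => y) (1 : R).
Proof. exact: is_derive_id. Qed.

Lemma is_derive_add f g x a b : is_derive x 1 f a -> is_derive x 1 g b ->
  is_derive x 1 (fun y => f y + g y) (a + b).
Proof. by move=> fa gb; exact: is_deriveD. Qed.

Lemma is_derive_sub f g x a b : is_derive x 1 f a -> is_derive x 1 g b ->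
  is_derive x 1 (fun y => f y - g y) (a - b).
Proof. by move=> fa gb; exact: is_deriveB. Qed.

Lemma is_derive_mul f g x a b : is_derive x 1 f a -> is_derive x 1 g b ->
  is_derive x 1 (fun y => f y * g y) (a * g x + f x * b).
Proof.
move=> fa gb; apply: (is_derive_eq (is_deriveM fa gb)).
by rewrite /GRing.scale /=; ring.
Qed.

Lemma is_derive_affine a b x : is_derive x 1 (fun y => a * y + b) a.
Proof.
have da : is_derive x 1 (fun y => a * y) a.
  apply: (is_derive_eq (is_derive_mul (is_derive_const a x) (is_derive_var x))).
  by rewrite mul0r add0r mulr1.
by apply: (is_derive_eq (is_derive_add da (is_derive_const b x))); rewrite addr0.
Qed.

Lemma is_derive_scale a f x b : is_derive x 1 f b ->
  is_derive x 1 (fun y => a * f y) (a * b).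
Proof.
move=> fb; apply: (is_derive_eq (is_derive_mul (is_derive_const a x) fb)).
by rewrite mul0r add0r.
Qed.

Lemma is_derive_comp_affine f x a b c : is_derive (a * x + b) 1 f c ->
  is_derive x 1 (fun y => f (a * y + b)) (a * c).
Proof.
move=> fc; rewrite mulrC.
exact: (is_derive1_comp (g := fun y => a * y + b) fc (is_derive_affine a b x)).
Qed.

Lemma is_derive_continuous f x a : is_derive x 1 f a -> {for x, continuous f}.
Proof.
by move=> fa; apply: differentiable_continuous; apply/derivable1_diffP; case: fa.
Qed.

Lemma is_derive_le f f' a b : a <= b ->
  (forall x, a <= x <= b -> is_derive x 1 f (f' x)) ->
  (forall x, a <= x <= b -> 0 <= f' x) -> f a <= f b.
Proof.
move=> ab df f'0.
have [x||c] := @MVT_segment R f f' a b ab.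
- by rewrite in_itv/= => /andP[/ltW ax /ltW xb]; apply: df; rewrite ax.
- apply: derivable_within_continuous => x; rewrite in_itv/= => xab.
  by case: (df x xab).
- rewrite in_itv/= => cab fab; rewrite -subr_ge0 fab mulr_ge0 ?f'0//.
  by rewrite subr_ge0.
Qed.

Lemma is_derive_eq_ends f f' a b : a <= b ->
  (forall x, a <= x <= b -> is_derive x 1 f (f' x)) ->
  (forall x, a <= x <= b -> f' x = 0) -> f a = f b.
Proof.
move=> ab df f'0; apply/eqP; rewrite eq_le; apply/andP; split.
  by apply: (is_derive_le ab df) => x /f'0 ->.
rewrite -lerN2; apply: (@is_derive_le (fun x => - f x) (fun x => - f' x) _ _ ab).
  by move=> x /df dx; exact: is_deriveN.
by move=> x /f'0 ->; rewrite oppr0.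
Qed.

(** The energy estimates below express integrals as increments of primitives, so that comparing
    integrals reduces to monotonicity. Later uses take [l = -1], which makes the derivative
    two-sided on all of [0, 2 pi]. *)
Lemma primitive_exists f l : continuous f ->
  exists F, forall x, l < x -> is_derive x 1 F (f x).
Proof.
move=> cf; pose F x := (\int[@lebesgue_measure R]_(t in `[l, x]) f t).
exists F => x lx.
have [] := @continuous_FTC1_closed R f l x (x + 1).
- by rewrite ltrDl.
- apply: continuous_compact_integrable; first exact: segment_compact.
  exact: continuous_subspaceT.
- exact: lx.
- exact: cf.
by move=> dF Fx; rewrite -Fx derive1E; apply: DeriveDef.
Qed.

Lemma Rintegral_primitive f F a b : a < b -> continuous f ->
  (forall x, a <= x <= b -> is_derive x 1 F (f x)) ->
  (\int[@lebesgue_measure R]_(t in `[a, b]) f t) = F b - F a.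
Proof.
move=> ab cf dF.
rewrite /Rintegral (@continuous_FTC2 R f F a b ab) //.
- exact: continuous_subspaceT.
- split.
  + move=> x; rewrite in_itv/= => /andP[/ltW ax /ltW xb].
    by have [] := dF x; rewrite ?ax.
  + apply: cvg_at_right_filter; apply: (is_derive_continuous (dF _ _)).
    by rewrite lexx ltW.
  + apply: cvg_at_left_filter; apply: (is_derive_continuous (dF _ _)).
    by rewrite lexx ltW.
- move=> x; rewrite in_itv/= => /andP[/ltW ax /ltW xb].
  by rewrite derive1E; have [] := dF x; rewrite ?ax.
Qed.

End derive_fun.

(** * Wirtinger's inequality *)

Section wirtinger.
Context {R : realType}.
Implicit Types (z zd P Q v : R -> R) (a b x : R).

(* With [T := tan (s * (x - a - pi / 2))], smooth on the whole interval as
   s < 1, one has zd^2 - s^2 z^2 + (s z^2 T)' = (zd + s z T)^2. *)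
Lemma half_wirtinger_aux s a z zd P Q : 0 < s < 1 ->
  (forall x, a <= x <= a + pi -> is_derive x 1 z (zd x)) ->
  (forall x, a <= x <= a + pi -> is_derive x 1 P (zd x ^+ 2)) ->
  (forall x, a <= x <= a + pi -> is_derive x 1 Q (z x ^+ 2)) ->
  z a = 0 -> z (a + pi) = 0 ->
  s ^+ 2 * (Q (a + pi) - Q a) <= P (a + pi) - P a.
Proof.
move=> /andP[s0 s1] dz dP dQ za zb.
pose c := - (s * (a + pi / 2)).
pose T x : R := tan (s * x + c).
have pi0 := @pi_gt0 R.
have dT x : a <= x <= a + pi -> is_derive x 1 T (s * (1 + T x ^+ 2)).
  move=> /andP[ax xb]; apply: is_derive_comp_affine.
  have cx : cos (s * x + c) != 0.
    by rewrite gt_eqF// cos_gt0_pihalf// /c; nra.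
  by rewrite -cos2_tan2//; exact: is_derive_tan.
pose Phi x := P x - s ^+ 2 * Q x + z x * z x * (s * T x).
suff : Phi a <= Phi (a + pi) by rewrite /Phi za zb !mul0r !addr0; lra.
apply: (is_derive_le (f' := fun x => (zd x + s * (z x * T x)) ^+ 2)).
- by lra.
- move=> x xab.
  have h1 := is_derive_sub (dP x xab) (is_derive_scale (s ^+ 2) (dQ x xab)).
  have h2 := is_derive_mul (is_derive_mul (dz x xab) (dz x xab))
                (is_derive_scale s (dT x xab)).
  by apply: (is_derive_eq (is_derive_add h1 h2)); rewrite /=; ring.
- by move=> x _; exact: sqr_ge0.
Qed.

(** The constant 1 is reached only as the limit of the constants [s ^+ 2]: for s = 1 the tangent has
    poles at both ends of the interval. *)
Lemma half_wirtinger a z zd P Q :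
  (forall x, a <= x <= a + pi -> is_derive x 1 z (zd x)) ->
  (forall x, a <= x <= a + pi -> is_derive x 1 P (zd x ^+ 2)) ->
  (forall x, a <= x <= a + pi -> is_derive x 1 Q (z x ^+ 2)) ->
  z a = 0 -> z (a + pi) = 0 -> Q (a + pi) - Q a <= P (a + pi) - P a.
Proof.
move=> dz dP dQ za zb.
set p := P _ - _; set q := Q _ - _.
have pq s : 0 < s < 1 -> s ^+ 2 * q <= p.
  by move=> s01; exact: (half_wirtinger_aux s01 dz dP dQ za zb).
have p0 : 0 <= p.
  rewrite subr_ge0; apply: (is_derive_le _ dP); first by have := @pi_gt0 R; lra.
  by move=> x _; exact: sqr_ge0.
rewrite leNgt; apply/negP => pltq.
have q0 : 0 < q by lra.
(* s^2 >= 2 s - 1, so s := (3 q + p) / (4 q) violates [pq] *)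
pose s := (3 * q + p) / (4 * q).
have sq : s * (4 * q) = 3 * q + p by rewrite /s mulfVK// gt_eqF//; lra.
have s01 : 0 < s < 1.
  by rewrite /s divr_gt0 ?ltr_pdivrMr//=; lra.
have := pq s s01; nra.
Qed.

(** Take the test function x (pi - x) in the Dirichlet inequality on [0, pi]: its square has
    integral pi^5 / 30, the square of its derivative pi^3 / 3. *)
Lemma pi_sqr_le : (pi : R) ^+ 2 <= 10.
Proof.
have pi0 := @pi_gt0 R.
pose z (x : R) := (x * (pi - x)).
pose zd (x : R) := pi - 2 * x.
have idd (x : R) := is_derive_var x.
have dz (x : R) : is_derive x 1 z (zd x).
  apply: (is_derive_eq (is_derive_mul (idd x)
    (is_derive_sub (is_derive_const pi x) (idd x)))).
  by rewrite /zd; ring.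
pose P (x : R) := - 6^-1 * ((zd x) * (zd x) * (zd x)).
pose Q (x : R) := pi ^+ 2 / 3 * (x * x * x) - pi / 2 * (x * x * (x * x)) +
  5^-1 * (x * x * (x * x) * x).
have dzd (x : R) : is_derive x 1 zd (- 2).
  apply: (is_derive_eq (is_derive_sub (is_derive_const pi x)
    (is_derive_scale 2 (idd x)))).
  by ring.
have dP (x : R) : is_derive x 1 P (zd x ^+ 2).
  apply: (is_derive_eq (is_derive_scale (-6^-1)
    (is_derive_mul (is_derive_mul (dzd x) (dzd x)) (dzd x)))).
  by field.
have dQ (x : R) : is_derive x 1 Q (z x ^+ 2).
  have d2 := is_derive_mul (idd x) (idd x).
  have d3 := is_derive_mul d2 (idd x).
  have d4 := is_derive_mul d2 d2.
  have d5 := is_derive_mul d4 (idd x).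
  apply: (is_derive_eq (is_derive_add
    (is_derive_sub (is_derive_scale (pi ^+ 2 / 3) d3)
      (is_derive_scale (pi / 2) d4)) (is_derive_scale (5^-1) d5))).
  by rewrite /z; field.
have := @half_wirtinger 0 z zd P Q (fun x _ => dz x) (fun x _ => dP x) (fun x _ => dQ x).
rewrite add0r /z mul0r subrr mulr0 => /(_ erefl erefl).
rewrite /P /Q /zd => h.
have : (pi : R) ^+ 3 * (pi ^+ 2 - 10) <= 0 by move: h; nra.
by rewrite pmulr_rle0 ?exprn_gt0// subr_le0.
Qed.

(* Hardy-Littlewood-Polya: some half period has equal end values [c]; apply the
   Dirichlet version to [v - c] on both halves. *)
Lemma wirtinger v v' V P Q :
  (forall x, is_derive x 1 v (v' x)) ->
  (forall x, -1 < x -> is_derive x 1 V (v x)) ->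
  (forall x, -1 < x -> is_derive x 1 P (v' x ^+ 2)) ->
  (forall x, -1 < x -> is_derive x 1 Q (v x ^+ 2)) ->
  (forall x, v (x + 2 * pi) = v x) -> (forall x, v' (x + 2 * pi) = v' x) ->
  V (2 * pi) = V 0 ->
  Q (2 * pi) - Q 0 <= P (2 * pi) - P 0.
Proof.
move=> dv dV dP dQ pv pv' V0.
have pi0 := @pi_gt0 R.
have [a a0pi va] : exists2 a, 0 <= a <= pi & v (a + pi) = v a.
  (* Periodicity gives h(pi) = - h(0), so h vanishes somewhere in [0, pi]. The factor [1 *] matches
     the form of [is_derive_comp_affine]. *)
  pose h x := v (1 * x + pi) - v x.
  have ch : {within `[0, pi], continuous h}.
    apply: continuous_subspaceT => y.
    exact: is_derive_continuous (is_derive_sub (is_derive_comp_affine (dv _)) (dv y)).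
  have hpi : h pi = - h 0.
    rewrite /h mulr0 mul1r add0r opprB; congr (_ - _).
    by rewrite -[RHS]pv; congr v; ring.
  have [|a] := @IVT R h 0 pi 0 (ltW pi0) ch.
    by rewrite hpi ge_min le_max; case: (leP 0 (h 0)) => ? /=; lra.
  rewrite in_itv/= => a0pi ha; exists a => //.
  by apply/eqP; rewrite -subr_eq0 -ha /h mul1r.
have ea : a + pi + pi = a + 2 * pi by ring.
(* The increment of a primitive of a periodic function over one period does not depend on the
   starting point, so [a, a + 2 pi] may replace [0, 2 pi]. *)
have per (F F' : R -> R) : (forall x, -1 < x -> is_derive x 1 F (F' x)) ->
    (forall x, F' (x + 2 * pi) = F' x) ->
    F (a + 2 * pi) - F a = F (2 * pi) - F 0.
  move=> dF pF; pose h x := F (1 * x + 2 * pi) - F x.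
  have : h 0 = h a.
    apply: (@is_derive_eq_ends _ h (fun x => 1 * F' (1 * x + 2 * pi) - F' x)).
    - by lra.
    - move=> x xa; apply: is_derive_sub; last by apply: dF; lra.
      by apply: is_derive_comp_affine; apply: dF; lra.
    - by move=> x _; rewrite !mul1r pF subrr.
  by rewrite /h mulr0 add0r mul1r => <-.
pose c := v a.
pose z x := v x - c.
have dz x : is_derive x 1 z (v' x).
  by apply: (is_derive_eq (is_derive_sub (dv x) (is_derive_const c x))); rewrite subr0.
pose Qz x := Q x - (2 * c) * V x + (c ^+ 2 * x + 0).
have dQz x : -1 < x -> is_derive x 1 Qz (z x ^+ 2).
  move=> x1; apply: (is_derive_eq (is_derive_add
    (is_derive_sub (dQ x x1) (is_derive_scale (2 * c) (dV x x1)))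
    (is_derive_affine (c ^+ 2) 0 x))).
  by rewrite /z; ring.
have half b : a <= b -> z b = 0 -> z (b + pi) = 0 ->
    Qz (b + pi) - Qz b <= P (b + pi) - P b.
  move=> ab zb zb'; apply: (@half_wirtinger b z v' P Qz) => // x xb.
  - by apply: dP; lra.
  - by apply: dQz; lra.
have za : z a = 0 by rewrite /z subrr.
have zpi : z (a + pi) = 0 by rewrite /z va subrr.
have h1 := half a (lexx _) za zpi.
have : z (a + pi + pi) = 0 by rewrite ea /z pv subrr.
move=> /(half (a + pi) _ zpi); rewrite ea => h2.
have {}h2 := h2 ltac:(lra).
rewrite -(per P _ dP); last by move=> x; rewrite pv'.
rewrite -(per Q _ dQ); last by move=> x; rewrite pv.
have VV : V (a + 2 * pi) - V a = 0 by rewrite (per V _ dV)// V0 subrr.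
move: h1 h2; rewrite /Qz.
have -> : V (a + 2 * pi) = V a by apply/eqP; rewrite -subr_eq0 VV.
(* As v has mean zero, the integral of (v - c)^2 over a period exceeds that of v^2 by 2 pi c^2. *)
have : 0 <= c ^+ 2 * (2 * pi) by rewrite mulr_ge0 ?sqr_ge0//; lra.
lra.
Qed.

End wirtinger.

(** * The trapezoidal rule *)

Section trapezoid.
Context {R : realType}.
Implicit Types (f g P U : R -> R) (u : nat -> R -> R) (x S : R) (m M : nat).

Lemma is_derive_bigsum n (h : nat -> R -> R) (h' : nat -> R) x :
  (forall i, is_derive x 1 (h i) (h' i)) ->
  is_derive x 1 (fun y => \sum_(0 <= i < n) h i y) (\sum_(0 <= i < n) h' i).
Proof.
move=> dh; elim: n => [|n IH].
  rewrite big_nil [X in is_derive _ _ X _](_ : _ = fun=> 0); first exact: is_derive_const.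
  by apply: funext => y; rewrite big_nil.
rewrite big_nat_recr//=.
rewrite [X in is_derive _ _ X _](_ : _ =
  fun y => \sum_(0 <= i < n) h i y + h n y).
  exact: is_derive_add.
by apply: funext => y; rewrite big_nat_recr.
Qed.

Lemma continuous_bigsum n (h : nat -> R -> R) x :
  (forall i, {for x, continuous (h i)}) ->
  {for x, continuous (fun y => \sum_(0 <= i < n) h i y)}.
Proof.
move=> ch; elim: n => [|n IH].
  rewrite (_ : (fun y => _) = fun=> 0); first exact: cvg_cst.
  by apply: funext => y; rewrite big_nil.
rewrite (_ : (fun y => _) = fun y => \sum_(0 <= i < n) h i y + h n y).
  by apply: continuousD.
by apply: funext => y; rewrite big_nat_recr.
Qed.

Lemma continuous_sqr f x : {for x, continuous f} ->
  {for x, continuous (fun y => f y ^+ 2)}.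
Proof. by move=> cf; apply: (continuousM cf cf). Qed.

Lemma continuous_scale f x (a : R) : {for x, continuous f} ->
  {for x, continuous (fun y => a * f y)}.
Proof. by move=> cf; exact: (continuousM (cvg_cst a) cf). Qed.

Lemma derive_periodic f g a : (forall x, is_derive x 1 f (g x)) ->
  (forall x, f (x + a) = f x) -> forall x, g (x + a) = g x.
Proof.
move=> dfg pf x; have [_ <-] := dfg x.
have fE : (fun y => f (1 * y + a)) = f by apply: funext => y; rewrite mul1r pf.
have : is_derive (1 * x + a) 1 f (g (1 * x + a)) by exact: dfg.
by move=> /is_derive_comp_affine; rewrite fE !mul1r => -[_ ->].
Qed.

(** Derivatives of a periodic function have mean zero, so Wirtinger's inequality bounds the energy
    of each one by that of the next, until the pointwise bound on [u m.+1] ends the chain. *)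
Lemma energy_le m u P S :
  (forall i x, (i <= m)%N -> is_derive x 1 (u i) (u i.+1 x)) ->
  continuous (u m.+1) -> (forall x, 0 <= x <= 2 * pi -> `|u m.+1 x| <= S) ->
  (forall x, u 0%N (x + 2 * pi) = u 0%N x) ->
  (forall x, -1 < x -> is_derive x 1 P (u 1%N x ^+ 2)) ->
  P (2 * pi) - P 0 <= 2 * pi * S ^+ 2.
Proof.
have pi0 := @pi_gt0 R.
elim: m u P => [|m IH] u P du cu bu pu dP.
  pose h x := S ^+ 2 * x + 0 - P x.
  suff : h 0 <= h (2 * pi) by rewrite /h; lra.
  apply: (is_derive_le (f' := fun x => S ^+ 2 - u 1%N x ^+ 2)); first lra.
    by move=> x x0; apply: is_derive_sub (is_derive_affine _ _ _) (dP _ _); lra.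
  by move=> x /bu /ler_normlP[]; nra.
have c2 : continuous (fun x => u 2%N x ^+ 2).
  move=> x; have [m0|m0] := eqVneq m 0%N.
    by move: (cu x); rewrite m0; exact: continuous_sqr.
  have := is_derive_continuous (du 2%N x _); rewrite ltnS lt0n => /(_ m0).
  exact: continuous_sqr.
have [P2 dP2] := primitive_exists (-1) c2.
have pu1 := derive_periodic (fun x => du 0%N x (leq0n _)) pu.
have pu2 := derive_periodic (fun x => du 1%N x (ltn0Sn _)) pu1.
apply: le_trans (_ : P2 (2 * pi) - P2 0 <= _).
  apply: (@wirtinger R (u 1%N) (u 2%N) (u 0%N)) => //.
  - by move=> x; apply: du.
  - by move=> x _; apply: du.
  - by rewrite -[RHS]pu add0r.
apply: (IH (fun i => u i.+1)) => // i x im; exact: du.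
Qed.

(** Integration by parts turns the left side into the integral of (x - pi) u'. Weighting the two
    squares by S / 4 and 1 / S bounds it by S pi^3 / 6 + 2 pi S, which is at most 4 pi S as soon as
    pi^2 <= 12. *)
Lemma value_at_0_le m u U S :
  (forall i x, (i <= m)%N -> is_derive x 1 (u i) (u i.+1 x)) ->
  continuous (u m.+1) -> (forall x, 0 <= x <= 2 * pi -> `|u m.+1 x| <= S) ->
  (forall x, u 0%N (x + 2 * pi) = u 0%N x) ->
  (forall x, -1 < x -> is_derive x 1 U (u 0%N x)) ->
  `|2 * pi * u 0%N 0 - (U (2 * pi) - U 0)| <= 4 * pi * S.
Proof.
move=> du cu bu pu dU.
have pi0 := @pi_gt0 R.
(* The weights require division by S. Enlarging S by e / (4 pi) raises the bound by exactly e, which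
   covers S = 0. *)
wlog S0 : S bu / 0 < S => [H|].
  have S0 : 0 <= S by apply: le_trans (bu 0 _) => //; lra.
  apply/ler_addgt0Pr => e e0.
  apply: le_trans (H (S + e / (4 * pi)) _ _) _.
  - by move=> x /bu bux; apply: le_trans bux _; rewrite lerDl divr_ge0//; lra.
  - by rewrite ltr_wpDl// divr_gt0//; lra.
  - rewrite mulrDr lerD2l mulrC mulfVK// gt_eqF//; lra.
have c1 : continuous (fun x => u 1%N x ^+ 2).
  move=> x; have [m0|m0] := eqVneq m 0%N.
    by move: (cu x); rewrite m0; exact: continuous_sqr.
  have := is_derive_continuous (du 1%N x _); rewrite lt0n => /(_ m0).
  exact: continuous_sqr.
have [P dP] := primitive_exists (-1) c1.
have EP := energy_le du cu bu pu dP.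
(* A primitive of (x - pi) u'. Centring at pi makes the two boundary terms add up to 2 pi u(0). *)
pose W x := (1 * x + - pi) * u 0%N x - U x.
have dW x : -1 < x -> is_derive x 1 W ((x - pi) * u 1%N x).
  move=> x1; apply: (is_derive_eq (is_derive_sub (is_derive_mul
    (is_derive_affine 1 (- pi) x) (du 0%N x (leq0n _))) (dU x x1))).
  by ring.
have WE : W (2 * pi) - W 0 = 2 * pi * u 0%N 0 - (U (2 * pi) - U 0).
  by have := pu 0; rewrite add0r /W => ->; ring.
have pi2 := @pi_sqr_le R.
(* AM-GM: [|(x - pi) u'| <= S (x - pi)^2 / 4 + u'^2 / S] *)
pose B x := S / 12 * ((1 * x + - pi) * (1 * x + - pi) * (1 * x + - pi)) + S^-1 * P x.
have dB x : -1 < x ->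
    is_derive x 1 B (S / 4 * (x - pi) ^+ 2 + S^-1 * u 1%N x ^+ 2).
  move=> x1; have l := is_derive_affine 1 (- pi) x.
  apply: (is_derive_eq (is_derive_add (is_derive_scale (S / 12)
    (is_derive_mul (is_derive_mul l l) l)) (is_derive_scale S^-1 (dP x x1)))).
  by field; rewrite gt_eqF.
have BE : B (2 * pi) - B 0 <= 4 * pi * S.
  have : S^-1 * (P (2 * pi) - P 0) <= 2 * pi * S.
    by rewrite mulrC ler_pdivrMr//; apply: le_trans EP _; rewrite expr2 mulrA.
  rewrite /B => h.
  have : S * pi * pi ^+ 2 <= S * pi * 10 by rewrite ler_wpM2l// mulr_ge0// ltW.
  nra.
(* [b] stands for a sign: the values 1 and -1 give the two sides of the absolute value. *)
have amgm (x b : R) : b ^+ 2 = 1 ->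
    0 <= S / 4 * (x - pi) ^+ 2 + S^-1 * u 1%N x ^+ 2 - b * ((x - pi) * u 1%N x).
  move=> b2.
  have -> : S / 4 * (x - pi) ^+ 2 + S^-1 * u 1%N x ^+ 2 - b * ((x - pi) * u 1%N x)
      = S^-1 * (S / 2 * (x - pi) - b * u 1%N x) ^+ 2.
    have -> : S^-1 * u 1%N x ^+ 2 = S^-1 * (b ^+ 2 * u 1%N x ^+ 2) by rewrite b2 mul1r.
    by field; rewrite gt_eqF.
  by rewrite mulr_ge0 ?sqr_ge0// invr_ge0 ltW.
have bd (b : R) : b ^+ 2 = 1 -> b * (W (2 * pi) - W 0) <= B (2 * pi) - B 0.
  move=> b2; pose h x := B x - b * W x.
  suff : h 0 <= h (2 * pi) by rewrite /h; lra.
  apply: (is_derive_le _ _ (fun x _ => amgm x b b2)); first lra.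
  by move=> x x0; apply: is_derive_sub (dB _ _) (is_derive_scale _ (dW _ _)); lra.
rewrite -WE ler_norml; apply/andP; split.
  by have := bd (-1) ltac:(by rewrite sqrrN expr1n); lra.
by have := bd 1 (expr1n _ _); lra.
Qed.

(** The quadrature sum is 2 pi times the value at 0 of the averaged function [u 0], so the estimate
    at 0 applies. In the power [i.+1] in [u i], one factor 1 / M averages and the other i come from
    the chain rule. *)
Lemma trapezoid_le m M (g : nat -> R -> R) (G : R -> R) S : (0 < M)%N ->
  (forall i x, (i <= m)%N -> is_derive x 1 (g i) (g i.+1 x)) ->
  continuous (g m.+1) -> (forall x, 0 <= x <= 2 * pi -> `|g m.+1 x| <= S) ->
  (forall x, g 0%N (x + 2 * pi) = g 0%N x) ->
  (forall x, -1 < x -> is_derive x 1 G (g 0%N x)) ->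
  `|(G (2 * pi) - G 0) -
    2 * pi / M%:R * \sum_(1 <= s < M.+1) g 0%N (2 * pi * s%:R / M%:R)|
  <= 4 * pi * S / M%:R ^+ m.+1.
Proof.
move=> M0 dg cg bg pg dG.
have pi0 := @pi_gt0 R.
have Mr : 0 < M%:R :> R by rewrite ltr0n.
have Mn0 : M%:R != 0 :> R by rewrite gt_eqF.
pose c s : R := 2 * pi * s%:R / M%:R.
(* Averaging [g] over its translates by the nodes gives a function of period
   [2 * pi / M]; rescale it to period [2 * pi]. *)
pose u i x := M%:R^-1 ^+ i.+1 * \sum_(0 <= s < M) g i (M%:R^-1 * x + c s).
pose U x := \sum_(0 <= s < M) G (M%:R^-1 * x + c s).
have M1 : 1 <= M%:R :> R by rewrite ler1n.
have Mi1 : 0 < (M%:R^-1 : R) <= 1 by rewrite invr_gt0 Mr invf_le1.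
have c0 s : 0 <= c s by rewrite /c divr_ge0// mulr_ge0//; lra.
have cM : c M = 2 * pi by rewrite /c mulfK.
have cS s : M%:R^-1 * (2 * pi) + c s = c s.+1.
  by rewrite /c [s.+1%:R]mulrSr; field.
have du i x : (i <= m)%N -> is_derive x 1 (u i) (u i.+1 x).
  move=> im; have dux : is_derive x 1 (u i) (M%:R^-1 ^+ i.+1 *
      \sum_(0 <= s < M) (M%:R^-1 * g i.+1 (M%:R^-1 * x + c s))).
    apply: is_derive_scale; apply: is_derive_bigsum => s.
    by apply: is_derive_comp_affine; exact: dg.
  by apply: (is_derive_eq dux); rewrite -mulr_sumr mulrA -exprSr.
have dU x : -1 < x -> is_derive x 1 U (u 0%N x).
  move=> x1; rewrite /u expr1 mulr_sumr.
  apply: is_derive_bigsum => s; apply: is_derive_comp_affine; apply: dG.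
  by have := c0 s; nra.
have cu : continuous (u m.+1).
  move=> x; apply: continuous_scale.
  apply: continuous_bigsum => s.
  have cl := is_derive_continuous (is_derive_affine M%:R^-1 (c s) x).
  exact: (continuous_comp cl (cg _)).
have c_le s : (s <= M)%N -> c s <= 2 * pi.
  move=> sM; rewrite -cM /c ler_pM2r ?invr_gt0// ler_pM2l ?ler_nat//; lra.
have bu x : 0 <= x <= 2 * pi -> `|u m.+1 x| <= S / M%:R ^+ m.+1.
  move=> /andP[x0 x2].
  rewrite /u normrM ger0_norm ?exprn_ge0 ?invr_ge0// ?ler0n//.
  rewrite [leRHS]mulrC exprSr -exprVn -mulrA ler_wpM2l ?exprn_ge0 ?invr_ge0 ?ler0n//.
  rewrite mulrC ler_pdivrMr//.
  apply: le_trans (ler_norm_sum _ _ _) _.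
  apply: (@le_trans _ _ (\sum_(0 <= s < M) S)).
    apply: ler_sum_nat => s /= sM; apply: bg.
    have Mx : 0 <= M%:R^-1 * x by rewrite mulr_ge0// invr_ge0 ltW.
    rewrite addr_ge0//=.
    apply: le_trans (c_le s.+1 sM).
    by rewrite -cS lerD2r ler_pM2l ?invr_gt0.
  by rewrite sumr_const_nat subn0 mulr_natr.
(* Adding 2 pi to x moves each node to the next one; the last wraps around to the first by the
   periodicity of g. *)
have pu x : u 0%N (x + 2 * pi) = u 0%N x.
  rewrite /u; congr (_ * _).
  rewrite -[X in \sum_(0 <= s < X) _ = _](prednK M0).
  rewrite -[X in _ = \sum_(0 <= s < X) _](prednK M0).
  rewrite big_nat_recr//= [RHS]big_nat_recl//= addrC; congr (_ + _).
    by rewrite [in RHS]/c mulr0 mul0r addr0 -[RHS]pg mulrDr -addrA cS prednK// cM.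
  apply: eq_big_nat => s _; rewrite mulrDr -addrA cS.
  by [].
have := value_at_0_le du cu bu pu dU.
have -> : 2 * pi * u 0%N 0 = 2 * pi / M%:R * \sum_(1 <= s < M.+1) g 0%N (c s).
  rewrite /u expr1 mulrA; congr (_ * _).
  rewrite big_add1/= -[X in \sum_(0 <= s < X) _ = _](prednK M0).
  rewrite -[X in _ = \sum_(0 <= s < X) _](prednK M0).
  rewrite big_nat_recl//= big_nat_recr//= addrC; congr (_ + _).
    by rewrite prednK// cM mulr0 add0r /c mulr0 mul0r -[LHS]pg add0r.
  by apply: eq_big_nat => s _; rewrite mulr0 add0r.
(* The M translates of [0, 2 pi / M] tile [0, 2 pi], so the increments telescope. *)
have -> : U (2 * pi) - U 0 = G (2 * pi) - G 0.
  rewrite /U -sumrB -cM -[in RHS](_ : c 0%N = 0); last by rewrite /c mulr0 mul0r.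
  rewrite -(@telescope_sumr _ 0 M (fun s => G (c s)))//; apply: eq_big_nat => s _.
  by rewrite mulr0 add0r cM cS.
by rewrite distrC mulrA.
Qed.

End trapezoid.

(** * Gauss quadrature of negative powers *)

Section interpolation.
Context {R : realType}.
Implicit Types (f g : R -> R) (s : seq R).

(* A substitute for complete monotonicity, closed under divided differences in
   the variable [y ^+ 2]: no derivative is ever needed. *)
Inductive inv_positive : (R -> R) -> Prop :=
| inv_positive_const c : 0 <= c -> inv_positive (fun=> c)
| inv_positive_inv c : 0 <= c -> inv_positive (fun y => (y + c)^-1)
| inv_positive_add f g : inv_positive f -> inv_positive g ->
    inv_positive (fun y => f y + g y)
| inv_positive_mul f g : inv_positive f -> inv_positive g ->
    inv_positive (fun y => f y * g y).

Lemma inv_positive_ge0 f y : inv_positive f -> 0 < y -> 0 <= f y.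
Proof.
move=> + y0; elim=> {f} [//|c c0|f g _ f0 _ g0|f g _ f0 _ g0].
- by rewrite invr_ge0 addr_ge0// ltW.
- exact: addr_ge0.
- exact: mulr_ge0.
Qed.

Lemma inv_positive_exp n : inv_positive (fun y => y^-1 ^+ n).
Proof.
elim: n => [|n IH].
  rewrite (_ : (fun _ => _) = fun=> 1); first exact: inv_positive_const.
  by apply: funext => y; rewrite expr0.
rewrite (_ : (fun _ => _) = fun y => (y + 0)^-1 * y^-1 ^+ n).
  by apply: inv_positive_mul => //; exact: inv_positive_inv.
by apply: funext => y; rewrite addr0 exprS.
Qed.

Lemma inv_positive_divided_difference f t : inv_positive f -> 0 < t ->
  exists2 g, inv_positive g &
    forall y, 0 < y -> f y = f t + (t ^+ 2 - y ^+ 2) * g y.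
Proof.
move=> + t0; elim=> {f} [c c0|c c0|f g _ [f1 pf1 ef] _ [g1 pg1 eg]|
    f g pf [f1 pf1 ef] pg [g1 pg1 eg]].
- exists (fun=> 0); first exact: inv_positive_const.
  by move=> y _; rewrite mulr0 addr0.
- exists (fun y => (t + c)^-1 * ((y + c)^-1 * (y + t)^-1)).
    apply: inv_positive_mul.
      by apply: inv_positive_const; rewrite invr_ge0; lra.
    by apply: inv_positive_mul; apply: inv_positive_inv => //; exact: ltW.
  move=> y y0; field; rewrite !gt_eqF//; lra.
- exists (fun y => f1 y + g1 y); first exact: inv_positive_add.
  by move=> y y0; rewrite ef// eg//; ring.
- exists (fun y => f t * g1 y + f1 y * g y).
    apply: inv_positive_add; last exact: inv_positive_mul.
    apply: inv_positive_mul => //; apply: inv_positive_const.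
    exact: inv_positive_ge0.
  by move=> y y0; rewrite ef// mulrDl {1}(eg y y0); ring.
Qed.

(** Newton's form in the variable y^2, with one divided difference per node. Nodes may be repeated,
    as Hermite interpolation demands. *)
Lemma newton_interpolation s f : inv_positive f -> (forall t, t \in s -> 0 < t) ->
  exists p : {poly R}, exists g, [/\ (size p <= size s)%N, inv_positive g &
    forall y, 0 < y ->
      f y = p.[y ^+ 2] + \prod_(t <- s) (t ^+ 2 - y ^+ 2) * g y].
Proof.
elim: s f => [|t s IH] f pf s0.
  exists 0, f; split=> //; first by rewrite size_poly0.
  by move=> y _; rewrite horner0 big_nil mul1r add0r.
have [||g pg fE] := @inv_positive_divided_difference f t => //.
  by apply: s0; rewrite mem_head.
have [|p [h [sp ph gE]]] := IH g pg.
  by move=> x xs; apply: s0; rewrite in_cons xs orbT.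
exists ((f t)%:P + ((t ^+ 2)%:P - 'X) * p), h; split => //.
  rewrite (leq_trans (size_polyD _ _))// geq_max size_polyC.
  rewrite (leq_trans (leq_b1 _))//= (leq_trans (size_polyMleq _ _))//.
  by rewrite -opprB size_polyN size_XsubC.
by move=> y y0; rewrite fE// gE// big_cons !hornerE; ring.
Qed.

(* Doubling every node turns the Newton remainder into a square times a
   nonnegative function. *)
Lemma hermite_minorant n N (t : 'I_N -> R) : (forall j, 0 < t j) ->
  exists p : {poly R}, [/\ (size p <= 2 * N)%N,
    forall j, p.[t j ^+ 2] = (t j)^-1 ^+ n &
    forall y, 0 < y -> p.[y ^+ 2] <= y^-1 ^+ n].
Proof.
move=> t0; pose s := [seq t j | j <- enum 'I_N].
have sp x : x \in s ++ s -> 0 < x.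
  by rewrite mem_cat orbb => /mapP[j _ ->].
have [p [g [sz pg E]]] := newton_interpolation (inv_positive_exp n) sp.
exists p; split.
- by rewrite (leq_trans sz)// size_cat size_map size_enum_ord mul2n addnn.
- move=> j; rewrite E// big_cat/= [X in X * _](_ : _ = 0) ?mul0r ?addr0//.
  apply/eqP; rewrite mulf_eq0; apply/orP; left.
  rewrite prodf_seq_eq0; apply/hasP; exists (t j); last by rewrite /= subrr.
  by apply/mapP; exists j => //; rewrite mem_enum.
- move=> y y0; rewrite [leRHS]E// lerDl mulr_ge0//; last exact: inv_positive_ge0.
  by rewrite big_cat/= -expr2 sqr_ge0.
Qed.

End interpolation.

(** * The substitution x = r^2 on an open interval *)

Section substitution.
Context {R : realType}.
Notation mu := (@lebesgue_measure R).
Implicit Types (b : R) (h : R -> R).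

Lemma is_derive_sqr (x : R) : is_derive x 1 (fun y : R => y ^+ 2) (2 * x).
Proof.
apply: (is_derive_eq (is_derive_mul (is_derive_var x) (is_derive_var x))).
by rewrite mul1r mulr1 mulr2n mulrDl mul1r.
Qed.

Lemma sqrt_lt_sqr b x : 0 < b -> 0 < x < b ^+ 2 -> 0 < Num.sqrt x < b.
Proof.
move=> b0 /andP[x0 xb]; rewrite sqrtr_gt0 x0/= -[ltRHS](gtr0_norm b0).
by rewrite -sqrtr_sqr ltr_sqrt// exprn_gt0.
Qed.

Lemma continuous_comp_sqrt b h x : 0 < b ->
  (forall r, 0 < r < b -> {for r, continuous h}) -> 0 < x < b ^+ 2 ->
  {for x, continuous (fun y => h (Num.sqrt y))}.
Proof.
move=> b0 ch xb; apply: (@continuous_comp _ _ _ (@Num.sqrt R) h).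
  exact: sqrt_continuous.
by apply: ch; exact: sqrt_lt_sqr.
Qed.

Lemma measurable_oo (a b : R) (g : R -> R) :
  (forall x, a < x < b -> {for x, continuous g}) ->
  measurable_fun (`]a, b[ : set R) g.
Proof.
move=> cg; apply: open_continuous_measurable_fun; first exact: interval_open.
by move=> x; rewrite inE/= in_itv/=; exact: cg.
Qed.

Lemma integral_sqrt_subst_cc h (a c : R) : 0 < a -> a < c ->
  (forall r, a <= r <= c -> {for r, continuous h}) ->
  (\int[mu]_(x in `[(a ^+ 2)%R, (c ^+ 2)%R]) (h (Num.sqrt x))%:E =
   \int[mu]_(r in `[a, c]) (h r * (2 * r))%:E)%E.
Proof.
move=> a0 ac ch.
have dF (x : R) := is_derive_sqr x.
have F'E : (fun y : R => y ^+ 2)^`()%classic = (fun x => 2 * x).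
  by apply: funext => x; rewrite derive1E; case: (dF x).
have c2 (x : R) : {for x, continuous (fun x : R => 2 * x)}.
  exact: is_derive_continuous (is_derive_scale 2 (is_derive_var x)).
rewrite (@integration_by_substitution_increasing R (fun y => y ^+ 2) (h \o Num.sqrt) a c).
- apply: eq_integral => x; rewrite inE/= in_itv/= => /andP[ax xc].
  congr EFin; rewrite F'E /GRing.mul/= sqrtr_sqr ger0_norm//.
  by apply: le_trans ax; exact: ltW.
- exact: ltW.
- move=> x y; rewrite !in_itv/= => /andP[ax _] /andP[ay _] xy.
  by rewrite ltr_pXn2r// nnegrE; lra.
- by rewrite F'E => x _; exact: c2.
- by rewrite F'E; apply/cvg_ex; exists (2 * a); apply: cvg_at_right_filter; exact: c2.
- by rewrite F'E; apply/cvg_ex; exists (2 * c); apply: cvg_at_left_filter; exact: c2.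
- split.
  + by move=> x _; case: (dF x).
  + by apply: cvg_at_right_filter; exact: is_derive_continuous (dF _).
  + by apply: cvg_at_left_filter; exact: is_derive_continuous (dF _).
- apply: continuous_in_subspaceT => x; rewrite inE/= in_itv/= => /andP[ax xc].
  apply: continuous_comp; first exact: sqrt_continuous.
  apply: ch.
  rewrite -[leLHS](gtr0_norm a0) -[c](@gtr0_norm _ c); last lra.
  by rewrite -!sqrtr_sqr !ler_wsqrtr.
Qed.

(** Nothing is known of h at the two ends. The substitution is made on the closed intervals [I n],
    which exhaust ]0, b[, and passes to the limit by monotone convergence. *)
Lemma ge0_integral_sqrt_subst h b : 0 < b ->
  (forall r, 0 < r < b -> {for r, continuous h}) ->
  (forall r, 0 < r < b -> 0 <= h r) ->
  (\int[mu]_(x in `]0%R, (b ^+ 2)%R[) (h (Num.sqrt x))%:E =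
   \int[mu]_(r in `]0%R, b[) (h r * (2 * r))%:E)%E.
Proof.
move=> b0 ch h0.
(* The shift by 3 makes the interval from [d n] to [b - d n] nondegenerate already for n = 0. *)
pose d (n : nat) : R := b / n.+3%:R.
have d0 n : 0 < d n by rewrite divr_gt0.
have db n : d n < b - d n.
  rewrite ltrBrDl -mulr2n /d -mulrnAl ltr_pdivrMr ?ltr0n// -[b *+ 2]mulr_natr.
  by rewrite ltr_pM2l// ltr_nat.
have dd m n : (m <= n)%N -> d n <= d m.
  by move=> mn; rewrite ler_pM2l// lef_pV2 ?posrE ?ltr0n// ler_nat.
have dlim (e : R) : 0 < e -> exists n, d n < e.
  move=> e0; exists (Num.truncn (b / e)).
  rewrite /d ltr_pdivrMr ?ltr0n// mulrC -ltr_pdivrMr//.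
  apply: lt_le_trans (truncnS_gt _) _.
  by rewrite ler_nat; apply: leqW; exact: leqnSn.
pose I n : set R := `[d n, b - d n]%classic.
pose J n : set R := `[(d n ^+ 2)%R, ((b - d n) ^+ 2)%R]%classic.
have sqI n x : J n x -> I n (Num.sqrt x).
  rewrite /I /J /= !in_itv/= => /andP[h1 h2]; have := db n; have := d0 n => ? ?.
  rewrite -[leLHS](gtr0_norm (d0 n)) -[b - d n](@gtr0_norm _ (b - d n)); last lra.
  by rewrite -!sqrtr_sqr !ler_wsqrtr.
have Isub n x : I n x -> 0 < x < b.
  by rewrite /I /= in_itv/=; have := d0 n; lra.
have UI : \bigcup_n I n = `]0, b[%classic.
  apply/seteqP; split=> [x [n _ /Isub]|x].
    by rewrite /= in_itv.
  rewrite /= in_itv/= => xb.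
  have [|n dn] := dlim (Num.min x (b - x)); first by rewrite lt_min; lra.
  by exists n => //; rewrite /I/= in_itv/=; move: dn; rewrite lt_min; lra.
have UJ : \bigcup_n J n = `]0, (b ^+ 2)[%classic.
  apply/seteqP; split=> [x [n _ Jx]|x].
    have := Isub _ _ (sqI _ _ Jx) => /andP[x0 xb].
    move: x0; rewrite /= in_itv/= sqrtr_gt0 => x0; rewrite x0/=.
    by rewrite -(sqr_sqrtr (ltW x0)) ltr_pXn2r// nnegrE ?sqrtr_ge0// ltW.
  rewrite /= in_itv/= => xb; have xb' := sqrt_lt_sqr b0 xb.
  have : (\bigcup_n I n) (Num.sqrt x) by rewrite UI /= in_itv.
  move=> [n _]; rewrite /I/= in_itv/= => /andP[h1 h2]; exists n => //.
  have dn := d0 n; have dbn := db n.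
  rewrite /J/= in_itv/= -(sqr_sqrtr (_ : 0 <= x)); last by lra.
  by rewrite !ler_pXn2r// ?nnegrE ?sqrtr_ge0//; lra.
have lI : (fun n => \int[mu]_(r in I n) (h r * (2 * r))%:E)%E @ \oo -->
    (\int[mu]_(r in `]0%R, b[) (h r * (2 * r))%:E)%E.
  rewrite -UI; apply: ge0_nondecreasing_set_cvg_integral.
  - move=> m n mn; apply/subsetPset => x; rewrite /I/= !in_itv/=.
    by have := dd _ _ mn; lra.
  - by move=> n; exact: measurable_itv.
  - move=> n; apply: (@measurable_funS _ _ _ _ `]0, b[) => //.
      by move=> x /Isub; rewrite /= in_itv.
    apply/measurable_EFinP; apply: measurable_oo => r rb.
    apply: continuousM; first exact: ch.
    exact: is_derive_continuous (is_derive_scale 2 (is_derive_var r)).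
  - move=> n x /Isub xb; rewrite lee_fin mulr_ge0 ?h0//; lra.
have lJ : (fun n => \int[mu]_(r in J n) (h (Num.sqrt r))%:E)%E @ \oo -->
    (\int[mu]_(r in `]0%R, (b ^+ 2)%R[) (h (Num.sqrt r))%:E)%E.
  rewrite -UJ; apply: ge0_nondecreasing_set_cvg_integral.
  - move=> m n mn; apply/subsetPset => x; rewrite /J/= !in_itv/= => /andP[h1 h2].
    have dmn := dd _ _ mn.
    have := d0 m; have := d0 n; have := db m; have := db n => ? ? ? ?.
    apply/andP; split; [apply: le_trans h1|apply: (le_trans h2)].
      by rewrite ler_pXn2r// nnegrE ltW.
    by rewrite ler_pXn2r// ?nnegrE; lra.
  - by move=> n; exact: measurable_itv.
  - move=> n; apply: (@measurable_funS _ _ _ _ `]0, (b ^+ 2)[) => //.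
      by move=> x Jx; rewrite -UJ; exists n.
    apply/measurable_EFinP; apply: measurable_oo => r rb.
    exact: continuous_comp_sqrt ch rb.
  - by move=> n x /sqI /Isub xb; rewrite lee_fin h0.
have IJ : (fun n => \int[mu]_(r in J n) (h (Num.sqrt r))%:E)%E =
    (fun n => \int[mu]_(r in I n) (h r * (2 * r))%:E)%E.
  apply: funext => n; apply: integral_sqrt_subst_cc => // r rI; apply: ch.
  by apply: (Isub n); rewrite /I/= in_itv.
by apply: cvg_unique lJ _ => //; rewrite IJ.
Qed.

End substitution.

(** * The bound on the Gauss weights *)

Section gauss.
Context {R : realType}.
Notation mu := (@lebesgue_measure R).
Implicit Types (b : R) (h : R -> R).

Lemma powR_half (x : R) k : 0 <= x -> x `^ (k%:R / 2) = Num.sqrt x ^+ k.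
Proof.
by move=> x0; rewrite mulrC powRrM powR12_sqrt// powR_mulrn// sqrtr_ge0.
Qed.

Lemma powR_Nhalf (x : R) k : 0 <= x -> x `^ (- (k%:R / 2)) = (Num.sqrt x)^-1 ^+ k.
Proof. by move=> x0; rewrite powRN powR_half// exprVn. Qed.

Lemma Rintegral_sum (D : set R) n (F : nat -> R -> R) : measurable D ->
  (forall i, mu.-integrable D (EFin \o F i)) ->
  mu.-integrable D (EFin \o (fun x => \sum_(i < n) F i x)) /\
  \int[mu]_(x in D) (\sum_(i < n) F i x) = \sum_(i < n) \int[mu]_(x in D) F i x.
Proof.
move=> mD iF; elim: n => [|n [IH1 IH2]].
  have -> : (fun x => \sum_(i < 0) F i x) = cst 0.
    by apply: funext => x; rewrite big_ord0.
  split; last by rewrite big_ord0 /Rintegral integral0.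
  exact: (@integrable0 _ _ _ mu D).
have E : (fun x => \sum_(i < n.+1) F i x) = (fun x => \sum_(i < n) F i x + F n x).
  by apply: funext => x; rewrite big_ord_recr.
rewrite E big_ord_recr/= -IH2; split; last exact: RintegralD.
exact: (@integrableD _ _ _ mu D mD _ _ IH1 (iF n)).
Qed.

Lemma integrable_comp_sqrt b h : 0 < b ->
  (forall r, 0 < r < b -> {for r, continuous h}) ->
  mu.-integrable `]0, b[ (fun r => (`|h r| * r)%:E) ->
  mu.-integrable `]0, b ^+ 2[ (fun x => (h (Num.sqrt x))%:E).
Proof.
move=> b0 ch ih.
have mb : measurable (`]0, b[%classic : set R) by exact: measurable_itv.
have mD : measurable (`]0, b ^+ 2[%classic : set R) by exact: measurable_itv.
have mV : measurable_fun (`]0, b ^+ 2[%classic : set R) (fun x => h (Num.sqrt x)).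
  by apply: measurable_oo => x xb; exact: (continuous_comp_sqrt b0 ch xb).
have i2h : mu.-integrable `]0, b[ (fun r => (`|h r| * (2 * r))%:E).
  rewrite [X in mu.-integrable _ X](_ : _ = (fun r => 2%:E * (`|h r| * r)%:E)%E).
    exact: integrableZl.
  by apply: funext => r; rewrite -EFinM mulrCA.
apply/integrableP; split; first exact/measurable_EFinP.
rewrite (@ge0_integral_sqrt_subst R (fun r => `|h r|))//.
  case/integrableP : i2h => _; congr (_ < _)%E.
  apply: eq_integral => r; rewrite inE/= in_itv/= => /andP[/ltW r0 _].
  by rewrite ger0_norm// !mulr_ge0.
by move=> r /ch cr; apply: (continuous_comp cr); exact: norm_continuous.
Qed.

Lemma integrable_moment b h k s : 0 < b ->
  (forall r, 0 < r < b -> {for r, continuous h}) ->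
  mu.-integrable `]0, b[ (fun r => (`|h r| * r)%:E) ->
  mu.-integrable `]0, b ^+ 2[
    (fun x => (x ^+ s * (x `^ (k%:R / 2) * h (Num.sqrt x)))%:E).
Proof.
move=> b0 ch ih; have iV := integrable_comp_sqrt b0 ch ih.
have mD : measurable (`]0, b ^+ 2[%classic : set R) by exact: measurable_itv.
(* The value of x^s x^(k/2) at the right end x = b^2, hence a bound for this factor. *)
pose C := (b ^+ 2) ^+ s * b ^+ k.
apply: (@le_integrable _ _ _ mu _ mD _ (fun x => C%:E * (h (Num.sqrt x))%:E)%E).
- apply/measurable_EFinP; apply: measurable_funM.
    exact: exprn_measurable.
  apply: measurable_funM; first exact: measurable_funS (measurable_powR _).
  by case/integrableP : iV => /measurable_EFinP.
- move=> x; rewrite /= in_itv/= => /[dup] /(sqrt_lt_sqr b0) /andP[y0 yb] /andP[x0 xb].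
  rewrite lee_fin /C !normrM mulrA ler_wpM2r//.
  have x0' := ltW x0; have y0' := ltW y0; have b0' := ltW b0.
  rewrite powR_half// !ger0_norm ?exprn_ge0//.
  by apply: ler_pM; rewrite ?exprn_ge0// lerXn2r// ?nnegrE ?exprn_ge0// ltW.
- exact: integrableZl.
Qed.

(** With p the minorant of x^(-k/2), the left side is the Gauss sum of p. The rule is exact on p,
    and p(x) x^(k/2) <= 1 leaves half the integral of h(sqrt x), that is, the integral of h(r) r. *)
Lemma ge0_gauss_weight_le b h N k (t lambda : 'I_N -> R) : 0 < b -> (0 < N)%N ->
  (forall r, 0 < r < b -> {for r, continuous h}) ->
  (forall r, 0 < r < b -> 0 <= h r) ->
  mu.-integrable `]0, b[ (fun r => (`|h r| * r)%:E) ->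
  (forall j, 0 < t j < b ^+ 2) ->
  (forall j, 0 < lambda j) \/ (forall j, lambda j < 0) ->
  (forall s : nat, (s <= 2 * N - 1)%N ->
     \sum_(j < N) lambda j * t j ^+ s =
     1 / 2 * (\int[mu]_(x in `]0, b ^+ 2[)
       (x ^+ s * (x `^ (k%:R / 2) * h (Num.sqrt x))))) ->
  \sum_(j < N) `|lambda j| * t j `^ (- (k%:R / 2)) <=
    \int[mu]_(r in `]0, b[) (`|h r| * r).
Proof.
move=> b0 N0 ch h0 ih tb sl mom.
set D : set R := `]0, b ^+ 2[%classic.
pose V x := h (Num.sqrt x).
have mD : measurable D by exact: measurable_itv.
have mb : measurable (`]0, b[%classic : set R) by exact: measurable_itv.
have V0 x : D x -> 0 <= V x.
  by rewrite /D/= in_itv/= => xb; apply: h0; exact: sqrt_lt_sqr.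
have iV : mu.-integrable D (EFin \o V) by exact: integrable_comp_sqrt.
have VE : 1 / 2 * \int[mu]_(x in D) V x = \int[mu]_(r in `]0, b[) (`|h r| * r).
  rewrite /Rintegral ge0_integral_sqrt_subst//.
  rewrite [X in fine X](_ : _ =
    (\int[mu]_(r in `]0%R, b[) (2%:E * (`|h r| * r)%:E))%E); last first.
    apply: eq_integral => r; rewrite inE/= in_itv/= => /h0 hr.
    by rewrite ger0_norm// -EFinM mulrCA.
  rewrite integralZl// fineM//; last exact: integrable_fin_num.
  by rewrite mulrA div1r mulVf// mul1r.
pose P s x := x ^+ s * (x `^ (k%:R / 2) * V x).
have iP s : mu.-integrable D (EFin \o P s) by exact: integrable_moment.
pose y j := Num.sqrt (t j).
have y0 j : 0 < y j by rewrite sqrtr_gt0; case/andP : (tb j).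
have yE j : y j ^+ 2 = t j by rewrite sqr_sqrtr// ltW//; case/andP : (tb j).
have [p [sp pE ple]] := hermite_minorant k y0.
(* Negative weights would make the zeroth moment negative, but it is the integral of a nonnegative
   function. *)
have l0 j : 0 < lambda j.
  case: sl => // l0; have := mom 0%N (leq0n _).
  have : \sum_(i < N) lambda i * t i ^+ 0 < 0.
    rewrite (bigD1 j)//= expr0 mulr1 ltr_wnDr// sumr_le0// => i _.
    by rewrite expr0 mulr1 ltW.
  move=> /[swap] ->; rewrite ltNge mulr_ge0// Rintegral_ge0// => x Dx.
  by rewrite mulr_ge0 ?expr0// mulr_ge0 ?powR_ge0//; exact: V0.
have -> : \sum_(j < N) `|lambda j| * t j `^ (- (k%:R / 2)) =
    \sum_(j < N) lambda j * p.[t j].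
  apply: eq_bigr => j _; rewrite gtr0_norm// powR_Nhalf; last by rewrite -yE sqr_ge0.
  by have := pE j; rewrite yE => ->.
have iZ s : mu.-integrable D (EFin \o (fun x => p`_s * P s x)).
  exact: (@integrableZl _ _ _ mu D mD (p`_s) _ (iP s)).
(* Exactness of the rule on p, one monomial at a time: only exponents s < 2N occur. *)
have -> : \sum_(j < N) lambda j * p.[t j] =
    1 / 2 * \int[mu]_(x in D) (\sum_(s < 2 * N) (p`_s * P s x)).
  under eq_bigr do rewrite (horner_coef_wide _ sp) mulr_sumr.
  rewrite exchange_big/=.
  rewrite (Rintegral_sum _ mD iZ).2 mulr_sumr; apply: eq_bigr => s _.
  under eq_bigr do rewrite mulrCA.
  rewrite -mulr_sumr mom; last by rewrite -ltnS subn1 prednK ?muln_gt0.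
  by rewrite RintegralZl// mulrCA.
rewrite -VE; apply: ler_wpM2l; first by [].
apply: le_Rintegral => //.
  exact: (Rintegral_sum _ mD iZ).1.
move=> x Dx; have := Dx; rewrite /D/= in_itv/= => /andP[x0 xb].
rewrite (_ : \sum_(s < _) _ = p.[x] * Num.sqrt x ^+ k * V x); last first.
  rewrite (horner_coef_wide _ sp) !mulr_suml; apply: eq_bigr => s _.
  by rewrite /P (powR_half _ (ltW x0)) !mulrA.
rewrite -[leRHS]mul1r; apply: ler_wpM2r; first exact: V0.
have sx0 : 0 < Num.sqrt x by rewrite sqrtr_gt0.
have := ple _ sx0; rewrite (sqr_sqrtr (ltW x0)) exprVn => h1.
by rewrite -ler_pdivlMr ?exprn_gt0// div1r.
Qed.

(** A nonpositive h is handled by changing the signs of h and of the weights together, which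
    preserves the moment equations. *)
Lemma gauss_weight_le b h N k (t lambda : 'I_N -> R) : 0 < b -> (0 < N)%N ->
  (forall r, 0 < r < b -> {for r, continuous h}) ->
  (forall r, 0 < r < b -> 0 <= h r) \/ (forall r, 0 < r < b -> h r <= 0) ->
  mu.-integrable `]0, b[ (fun r => (`|h r| * r)%:E) ->
  (forall j, 0 < t j < b ^+ 2) ->
  (forall j, 0 < lambda j) \/ (forall j, lambda j < 0) ->
  (forall s : nat, (s <= 2 * N - 1)%N ->
     \sum_(j < N) lambda j * t j ^+ s =
     1 / 2 * (\int[mu]_(x in `]0, b ^+ 2[)
       (x ^+ s * (x `^ (k%:R / 2) * h (Num.sqrt x))))) ->
  \sum_(j < N) `|lambda j| * t j `^ (- (k%:R / 2)) <=
    \int[mu]_(r in `]0, b[) (`|h r| * r).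
Proof.
move=> b0 N0 ch [h0|h0] ih tb sl mom; first exact: ge0_gauss_weight_le.
under eq_bigr do rewrite -normrN.
under eq_Rintegral do rewrite -normrN.
apply: (@ge0_gauss_weight_le b (fun r => - h r) N k t (fun j => - lambda j)) => //.
- by move=> r /ch cr; exact: continuousN.
- by move=> r /h0; rewrite oppr_ge0.
- rewrite [X in mu.-integrable _ X](_ : _ = fun r => (`|h r| * r)%:E)//.
  by apply: funext => r; congr (_ * _)%:E; exact: normrN.
- by case: sl => sl; [right|left] => j; rewrite ?oppr_lt0 ?oppr_gt0.
- move=> s /mom mom_s; under eq_bigr do rewrite mulNr.
  rewrite sumrN mom_s -mulrN; congr (_ * _).
  have mD : measurable (`]0, b ^+ 2[%classic : set R) by exact: measurable_itv.
  have iM := integrable_moment k s b0 ch ih.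
  rewrite -[LHS]mulN1r -(@RintegralZl _ _ _ mu _
    (fun x => x ^+ s * (x `^ (k%:R / 2) * h (Num.sqrt x))) _ mD iM).
  by apply: eq_Rintegral => x _; rewrite mulN1r !mulrN.
Qed.

End gauss.

(** * Regularity in polar coordinates *)

Section chain_rule.
Context {R : realType}.
Implicit Types (F : R -> R) (f : R * R -> R) (p q : R * R).

Lemma is_derive0_eps F (x : R) :
  (forall e, 0 < e -> \forall z \near x, `|F z - F x| <= e * `|z - x|) ->
  is_derive x 1 F 0.
Proof.
move=> Fe; apply/is_derive1_caratheodory.
exists (fun z => (F z - F x) / (z - x)); split; last by rewrite !subrr mul0r.
  move=> z; have [->|zx] := eqVneq z x; first by rewrite !subrr mulr0.
  by rewrite mulfVK// subr_eq0.
rewrite /prop_for /continuous_at !subrr mul0r.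
apply/cvgr0Pnorm_le => e e0; near=> z.
have [->|zx] := eqVneq z x; first by rewrite !subrr mul0r normr0 ltW.
rewrite normrM normfV ler_pdivrMr ?normr_gt0 ?subr_eq0//.
by near: z; exact: Fe.
Unshelve. all: by end_near. Qed.

(** On the segment between a and b, both e s - (F(s) - c s) and e s + (F(s) - c s) are
    nondecreasing. Hypotheses on an interval symmetric about a serve either order of a and b. *)
Lemma mean_value_le F F' (a b c e : R) :
  (forall s, `|s - a| <= `|b - a| -> is_derive s 1 F (F' s)) ->
  (forall s, `|s - a| <= `|b - a| -> `|F' s - c| <= e) ->
  `|F b - F a - c * (b - a)| <= e * `|b - a|.
Proof.
move=> dF bF.
have dG (k : R) s : `|s - a| <= `|b - a| ->
    is_derive s 1 (fun s => k * (F s - (c * s + 0))) (k * (F' s - c)).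
  move=> h; apply: is_derive_scale; apply: is_derive_sub (dF _ h) _.
  exact: is_derive_affine.
have dH (k : R) s : `|s - a| <= `|b - a| ->
    is_derive s 1 (fun s => e * s + 0 - (k * (F s - (c * s + 0)))) (e - k * (F' s - c)).
  by move=> h; apply: is_derive_sub (is_derive_affine _ _ _) (dG _ _ h).
have [ab|/ltW ba] := leP a b.
  have itv s : a <= s <= b -> `|s - a| <= `|b - a|.
    by move=> ?; rewrite !ger0_norm; lra.
  rewrite (@ger0_norm _ (b - a)) ?subr_ge0// ler_norml; apply/andP; split.
    have := is_derive_le ab (fun s h => dH (-1) s (itv s h)) _.
    have h s : a <= s <= b -> 0 <= e - -1 * (F' s - c).
      by move=> /itv /bF; rewrite ler_norml; lra.
    by move=> /(_ h); lra.
  have := is_derive_le ab (fun s h => dH 1 s (itv s h)) _.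
  have h s : a <= s <= b -> 0 <= e - 1 * (F' s - c).
    by move=> /itv /bF; rewrite ler_norml; lra.
  by move=> /(_ h); lra.
have itv s : b <= s <= a -> `|s - a| <= `|b - a|.
  by move=> ?; rewrite !ler0_norm; lra.
rewrite (@ler0_norm _ (b - a)) ?subr_le0// ler_norml; apply/andP; split.
  have := is_derive_le ba (fun s h => dH 1 s (itv s h)) _.
  have h s : b <= s <= a -> 0 <= e - 1 * (F' s - c).
    by move=> /itv /bF; rewrite ler_norml; lra.
  by move=> /(_ h); lra.
have := is_derive_le ba (fun s h => dH (-1) s (itv s h)) _.
have h s : b <= s <= a -> 0 <= e - -1 * (F' s - c).
  by move=> /itv /bF; rewrite ler_norml; lra.
by move=> /(_ h); lra.
Qed.

Lemma is_derive_partial1 f (x y : R) : derivable f (x, y) (1, 0) ->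
  is_derive x 1 (fun s => f (s, y)) ('D_(1, 0) f (x, y)).
Proof.
have E : (fun h : R => h^-1 *: ((f \o shift (x, y)) (h *: ((1, 0) : R * R)) - f (x, y))) =
         (fun h : R =>
            h^-1 *: (((fun s => f (s, y)) \o shift x) (h *: (1 : R)) - f (x, y))).
  apply: funext => h /=; congr (_ *: (f _ - _)).
  rewrite /GRing.add/= /add_pair/= /GRing.scale/= /scale_pair/= /GRing.scale/=.
  by rewrite mulr0 add0r.
move=> d; apply: DeriveDef; first by move: d; rewrite /derivable E.
by rewrite /derive E.
Qed.

Lemma is_derive_partial2 f (x y : R) : derivable f (x, y) (0, 1) ->
  is_derive y 1 (fun s => f (x, s)) ('D_(0, 1) f (x, y)).
Proof.
have E : (fun h : R => h^-1 *: ((f \o shift (x, y)) (h *: ((0, 1) : R * R)) - f (x, y))) =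
         (fun h : R =>
            h^-1 *: (((fun s => f (x, s)) \o shift y) (h *: (1 : R)) - f (x, y))).
  apply: funext => h /=; congr (_ *: (f _ - _)).
  rewrite /GRing.add/= /add_pair/= /GRing.scale/= /scale_pair/= /GRing.scale/=.
  by rewrite mulr0 add0r.
move=> d; apply: DeriveDef; first by move: d; rewrite /derivable E.
by rewrite /derive E.
Qed.

(** Continuous partial derivatives imply differentiability: go from p to q through the corner (p.1,
    q.2) and use the mean value inequality on each leg. Balls of the product are squares, so they
    contain the corner. *)
Lemma partial_increment f p :
  (\forall q \near p, derivable f q (1, 0)) ->
  (\forall q \near p, derivable f q (0, 1)) ->
  {for p, continuous ('D_(1, 0) f)} -> {for p, continuous ('D_(0, 1) f)} ->
  forall e, 0 < e -> \forall q \near p,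
    `|f q - f p - ('D_(1, 0) f p * (q.1 - p.1) + 'D_(0, 1) f p * (q.2 - p.2))|
    <= e * (`|q.1 - p.1| + `|q.2 - p.2|).
Proof.
move=> d1 d2 c1 c2 e e0.
have b1 : \forall q \near p, `|'D_(1, 0) f q - 'D_(1, 0) f p| <= e.
  by have /cvgr_distC_le := c1; apply.
have b2 : \forall q \near p, `|'D_(0, 1) f q - 'D_(0, 1) f p| <= e.
  by have /cvgr_distC_le := c2; apply.
have [r /= r0 hr] := (nbhs_ballP _ _).1 (filterI (filterI d1 d2) (filterI b1 b2)).
apply/nbhs_ballP; exists r => // q pq.
have inball (u v : R) : `|u - p.1| <= `|q.1 - p.1| -> `|v - p.2| <= `|q.2 - p.2| ->
    ball p r (u, v).
  move: pq => [pq1 pq2] h1 h2; split; rewrite /ball/= distrC.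
  - by apply: le_lt_trans h1 _; rewrite distrC.
  - by apply: le_lt_trans h2 _; rewrite distrC.
have A1 : `|f (q.1, q.2) - f (p.1, q.2) - 'D_(1, 0) f p * (q.1 - p.1)|
    <= e * `|q.1 - p.1|.
  apply: (@mean_value_le (fun s => f (s, q.2)) (fun s => 'D_(1, 0) f (s, q.2))) => s hs.
    by apply: is_derive_partial1; have [[+ _] _] := hr _ (inball _ _ hs (lexx _)).
  by have [_ [h _]] := hr _ (inball _ _ hs (lexx _)); exact: h.
have A2 : `|f (p.1, q.2) - f (p.1, p.2) - 'D_(0, 1) f p * (q.2 - p.2)|
    <= e * `|q.2 - p.2|.
  have p1 : `|p.1 - p.1| <= `|q.1 - p.1| by rewrite subrr normr0.
  apply: (@mean_value_le (fun s => f (p.1, s)) (fun s => 'D_(0, 1) f (p.1, s))) => s hs.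
    by apply: is_derive_partial2; have [[_ +] _] := hr _ (inball _ _ p1 hs).
  by have [_ [_ h]] := hr _ (inball _ _ p1 hs); exact: h.
have -> : f q - f p - ('D_(1, 0) f p * (q.1 - p.1) + 'D_(0, 1) f p * (q.2 - p.2)) =
    (f (q.1, q.2) - f (p.1, q.2) - 'D_(1, 0) f p * (q.1 - p.1)) +
    (f (p.1, q.2) - f (p.1, p.2) - 'D_(0, 1) f p * (q.2 - p.2)).
  by rewrite -!surjective_pairing; ring.
by rewrite [leRHS]mulrDr; apply: le_trans (ler_normD _ _) _; exact: lerD.
Qed.

Lemma is_derive_curve f (u v : R -> R) (x u' v' : R) :
  (\forall q \near (u x, v x), derivable f q (1, 0)) ->
  (\forall q \near (u x, v x), derivable f q (0, 1)) ->
  {for (u x, v x), continuous ('D_(1, 0) f)} ->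
  {for (u x, v x), continuous ('D_(0, 1) f)} ->
  is_derive x 1 u u' -> is_derive x 1 v v' ->
  is_derive x 1 (fun z => f (u z, v z))
    ('D_(1, 0) f (u x, v x) * u' + 'D_(0, 1) f (u x, v x) * v').
Proof.
move=> d1 d2 c1 c2 du dv.
set p := (u x, v x); set a := 'D_(1, 0) f p; set b := 'D_(0, 1) f p.
(* The linear part of f along the curve. It remains to see that the difference has derivative 0, for
   which u and v are Lipschitz at x with constants C and C'. *)
pose G z := a * u z + b * v z.
have dG : is_derive x 1 G (a * u' + b * v').
  by apply: is_derive_add; exact: is_derive_scale.
have lip (w : R -> R) w' : is_derive x 1 w w' ->
    exists C, 0 <= C /\ \forall z \near x, `|w z - w x| <= C * `|z - x|.
  move=> /is_derive1_caratheodory[g [gE cg gx]]; exists (`|g x| + 1); split => //.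
  have : \forall z \near x, `|g z - g x| <= 1 by have /cvgr_distC_le := cg; apply.
  apply: filterS => z h; rewrite gE normrM ler_wpM2r//.
  by rewrite -[g z](subrK (g x)) (le_trans (ler_normD _ _))// addrC lerD2l.
have [C [C0 hC]] := lip _ _ du; have [C' [C'0 hC']] := lip _ _ dv.
have dFG : is_derive x 1 (fun z => f (u z, v z) - G z) 0.
  apply: is_derive0_eps => e e0.
  (* The error is at most e' (C + C') |z - x|; the summand 1 keeps the denominator positive. *)
  pose e' := e / (C + C' + 1).
  have e'0 : 0 < e' by rewrite divr_gt0//; lra.
  have cuv : (fun z => (u z, v z)) @ x --> p.
    exact: (cvg_pair (is_derive_continuous du) (is_derive_continuous dv)).
  near=> z.
  have : `|f (u z, v z) - f p - (a * (u z - u x) + b * (v z - v x))|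
      <= e' * (`|u z - u x| + `|v z - v x|).
    near: z; exact: (cuv _ (partial_increment d1 d2 c1 c2 e'0)).
  have h1 : `|u z - u x| <= C * `|z - x| by near: z.
  have h2 : `|v z - v x| <= C' * `|z - x| by near: z.
  rewrite (_ : _ - _ - _ = f (u z, v z) - G z - (f (u x, v x) - G x));
    last by rewrite /G; ring.
  move=> h; apply: le_trans h _.
  have eE : e' * (C + C' + 1) = e by rewrite /e' mulfVK// gt_eqF//; lra.
  apply: le_trans (_ : e' * ((C + C') * `|z - x|) <= _).
    by rewrite ler_wpM2l ?(ltW e'0)// mulrDl lerD.
  rewrite mulrA -eE ler_wpM2r// ler_wpM2l ?(ltW e'0)//; lra.
have := is_derive_add dFG dG; rewrite add0r.
rewrite (_ : (fun y => _) = (fun z => f (u z, v z)))//.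
by apply: funext => z; rewrite subrK.
Unshelve. all: by end_near. Qed.

End chain_rule.

(** * Angular derivatives of smooth functions on the disc *)

Section angular.
Context {R : realType}.
Implicit Types (rad r phi : R) (f : R * R -> R) (F G : R -> R -> R) (p : R * R).

Lemma continuous_sqr_norm : continuous (fun p : R * R => p.1 ^+ 2 + p.2 ^+ 2).
Proof.
move=> p; apply: (@continuousD _ _ _ (fun p : R * R => p.1 * p.1) (fun p => p.2 * p.2)).
  by apply: continuousM; exact: cvg_fst.
by apply: continuousM; exact: cvg_snd.
Qed.

Lemma open_disc rad : open (disc rad).
Proof.
have := open_comp (fun p _ => @continuous_sqr_norm p) (@open_lt R (rad ^+ 2)).
by [].
Qed.

Lemma compact_cdisc rad : 0 < rad -> compact (cdisc rad).
Proof.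
move=> r0; apply: (@subclosed_compact _ _
  (`[- rad, rad]%classic `*` `[- rad, rad]%classic)).
- have := closed_comp (fun p _ => @continuous_sqr_norm p) (@closed_le R (rad ^+ 2)).
  by [].
- by apply: compact_setX; exact: segment_compact.
- move=> [x y]; rewrite /cdisc/= !in_itv/= -!ler_norml => h.
  by split; rewrite -ler_sqr ?nnegrE ?(ltW r0)// real_normK ?num_real//;
    apply: le_trans h; rewrite ?lerDl ?lerDr sqr_ge0.
Qed.

Lemma extension_continuous rad f g : {within cdisc rad, continuous g} ->
  {in disc rad, f =1 g} -> forall p, disc rad p -> {for p, continuous f}.
Proof.
move=> cg fg p Dp.
have cgp : {for p, continuous g}.
  have : {within disc rad, continuous g}.
    by apply: continuous_subspaceW cg => q /ltW.
  by rewrite continuous_open_subspace; [apply; rewrite inE|exact: open_disc].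
have E : \forall q \near p, g q = f q.
  apply: filterS (open_nbhs_nbhs (conj (@open_disc rad) Dp)) => q Dq.
  by rewrite fg// inE.
rewrite /prop_for /continuous_at fg ?inE//.
by apply: cvg_trans cgp; exact: near_eq_cvg.
Qed.

Lemma extension_bounded rad f g : 0 < rad -> {within cdisc rad, continuous g} ->
  {in disc rad, f =1 g} -> exists B, forall p, disc rad p -> `|f p| <= B.
Proof.
move=> r0 cg fg.
have [M [_ hM]] := compact_bounded (continuous_compact cg (compact_cdisc r0)).
exists (M + 1) => p Dp; rewrite fg ?inE//.
by apply: (hM (M + 1)); [rewrite ltrDl|exists p => //; exact: ltW].
Qed.

Lemma disc_polar rad r phi : 0 <= r < rad -> disc rad (polar r phi).
Proof.
move=> /andP[r0 rr]; rewrite /disc/= !exprMn -mulrDr cos2Dsin2 mulr1.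
by rewrite ltrXn2r// (le_lt_trans r0).
Qed.

(* Bounds uniform in the radius make the outer supremum of [angular_bound] that
   of a bounded set, hence meaningful. *)
Fixpoint angular_class rad (m : nat) F : Prop :=
  [/\ exists B, forall r phi, 0 <= r < rad -> `|F r phi| <= B,
      forall r, 0 <= r < rad -> continuous (F r) &
      if m is m'.+1 then exists2 F', angular_class rad m' F' &
        forall r phi, 0 <= r < rad -> is_derive phi 1 (F r) (F' r phi)
      else True].

Lemma angular_classW rad m F : angular_class rad m.+1 F -> angular_class rad m F.
Proof.
elim: m F => [|m IH] F [bF cF [F' F'm dF]]; split => //.
by exists F' => //; exact: IH.
Qed.

Lemma angular_classD rad m F G : angular_class rad m F -> angular_class rad m G ->
  angular_class rad m (fun r phi => F r phi + G r phi).
Proof.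
elim: m F G => [|m IH] F G [[B hB] cF hF] [[C hC] cG hG].
  split=> //; first by exists (B + C) => r phi rr;
    rewrite (le_trans (ler_normD _ _))// lerD ?hB ?hC.
  by move=> r rr phi; apply: continuousD; [exact: cF|exact: cG].
split; first by exists (B + C) => r phi rr;
    rewrite (le_trans (ler_normD _ _))// lerD ?hB ?hC.
  by move=> r rr phi; apply: continuousD; [exact: cF|exact: cG].
have [F' F'm dF] := hF; have [G' G'm dG] := hG.
exists (fun r phi => F' r phi + G' r phi); first exact: IH.
by move=> r phi rr; apply: is_derive_add; [exact: dF|exact: dG].
Qed.

Lemma angular_classM rad m F G : angular_class rad m F -> angular_class rad m G ->
  angular_class rad m (fun r phi => F r phi * G r phi).
Proof.
elim: m F G => [|m IH] F G aF aG.
  move: aF aG => [[B hB] cF _] [[C hC] cG _]; split=> //.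
    by exists (B * C) => r phi rr; rewrite normrM ler_pM ?hB ?hC.
  by move=> r rr phi; apply: continuousM; [exact: cF|exact: cG].
(* The product rule pairs F' with G itself, which must therefore be taken one order lower. *)
have aFW := angular_classW aF; have aGW := angular_classW aG.
move: aF aG => [[B hB] cF [F' F'm dF]] [[C hC] cG [G' G'm dG]].
split.
- by exists (B * C) => r phi rr; rewrite normrM ler_pM ?hB ?hC.
- by move=> r rr phi; apply: continuousM; [exact: cF|exact: cG].
exists (fun r phi => F' r phi * G r phi + F r phi * G' r phi).
  by apply: angular_classD; exact: IH.
by move=> r phi rr; apply: is_derive_mul; [exact: dF|exact: dG].
Qed.

(** The phase d closes the family under differentiation, each derivative adding pi / 2 to it. The
    amplitude depends on r to cover the coefficients r and - r of the chain rule in polar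
    coordinates. *)
Lemma angular_class_cos rad m (a : R -> R) (c d : R) :
  (exists B, forall r, 0 <= r < rad -> `|a r| <= B) ->
  angular_class rad m (fun r phi => a r * cos (c * phi + d)).
Proof.
elim: m a d => [|m IH] a d [B hB].
  split=> //; first by exists B => r phi rr;
    rewrite normrM (le_trans _ (hB r rr))// ler_piMr// ler_norml cos_geN1 cos_le1.
  move=> r rr phi; exact: is_derive_continuous
    (is_derive_scale (a r) (is_derive_comp_affine (is_derive_cos _))).
split; first by exists B => r phi rr;
    rewrite normrM (le_trans _ (hB r rr))// ler_piMr// ler_norml cos_geN1 cos_le1.
  move=> r rr phi; exact: is_derive_continuous
    (is_derive_scale (a r) (is_derive_comp_affine (is_derive_cos _))).
exists (fun r phi => (a r * c) * cos (c * phi + (d + pi / 2))).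
  apply: (IH (fun r => a r * c)); exists (B * `|c|) => r rr.
  by rewrite normrM ler_wpM2r// hB.
move=> r phi rr; rewrite addrA cosDpihalf -mulrA.
by apply: is_derive_scale; apply: is_derive_comp_affine; exact: is_derive_cos.
Qed.

Lemma angular_class_sin rad m (a : R -> R) (c : R) :
  (exists B, forall r, 0 <= r < rad -> `|a r| <= B) ->
  angular_class rad m (fun r phi => a r * sin (c * phi)).
Proof.
move=> ha; have := @angular_class_cos rad m a c (- (pi / 2)) ha.
by under eq_fun do under eq_fun do rewrite cosBpihalf.
Qed.

Lemma angular_class_Y rad m k l : angular_class rad m (fun=> Y k l).
Proof.
have bc (c : R) : exists B, forall r, 0 <= r < rad -> `|c| <= B by exists `|c|.
rewrite /Y; case: k => [|k].
  have := @angular_class_cos rad m (fun=> 1 / Num.sqrt (2 * pi)) 0 0 (bc _).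
  by under eq_fun do under eq_fun do rewrite mul0r addr0 cos0 mulr1.
case: (l == 1%N); last by apply: angular_class_sin; exact: bc.
have := @angular_class_cos rad m (fun=> 1 / Num.sqrt pi) k.+1%:R 0 (bc _).
by under eq_fun do under eq_fun do rewrite addr0.
Qed.

(** By the chain rule the angular derivative is a combination of the two partials, of class one
    lower, with trigonometric coefficients. Uniform bounds come from the extensions to the compact
    closed disc. *)
Lemma angular_class_polar rad m f : 0 < rad -> partials_extend rad m f ->
  angular_class rad m (fun r phi => f (polar r phi)).
Proof.
move=> rad0; have cpolar r : continuous (fun phi => polar r phi).
  move=> phi; exact: (cvg_pair
    (is_derive_continuous (is_derive_scale r (is_derive_cos phi)))
    (is_derive_continuous (is_derive_scale r (is_derive_sin phi)))).
elim: m f => [|m IH] f [[g [cg fg]] hf].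
  have [B hB] := extension_bounded rad0 cg fg.
  split=> //; first by exists B => r phi rr; apply: hB; exact: disc_polar.
  move=> r rr phi; apply: continuous_comp; first exact: cpolar.
  by apply: (extension_continuous cg fg); exact: disc_polar.
have [B hB] := extension_bounded rad0 cg fg.
split; first by exists B => r phi rr; apply: hB; exact: disc_polar.
  move=> r rr phi; apply: continuous_comp; first exact: cpolar.
  by apply: (extension_continuous cg fg); exact: disc_polar.
have [df [p1 p2]] := hf.
have part_cont h : partials_extend rad m h ->
    forall p, disc rad p -> {for p, continuous h}.
  case: m {IH hf p1 p2} => [|m] [[g' [cg' hg']] _];
    exact: (extension_continuous cg' hg').
have br : exists B, forall r, 0 <= r < rad -> `|r| <= B.
  by exists rad => r rr; rewrite ger0_norm; lra.
have brN : exists B, forall r, 0 <= r < rad -> `|- r| <= B.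
  by exists rad => r rr; rewrite normrN ger0_norm; lra.
exists (fun r phi => 'D_(1, 0) f (polar r phi) * (- r * sin (1 * phi)) +
                     'D_(0, 1) f (polar r phi) * (r * cos (1 * phi + 0))).
  apply: angular_classD.
    apply: angular_classM (IH _ p1) _.
    exact: (@angular_class_sin rad m (fun r => - r)).
  apply: angular_classM (IH _ p2) _.
  exact: (@angular_class_cos rad m (fun r => r)).
move=> r phi rr; have Dp := disc_polar phi rr.
have near_disc : \forall q \near polar r phi, disc rad q.
  exact: open_nbhs_nbhs (conj (@open_disc rad) Dp).
apply: (@is_derive_curve R f (fun z => r * cos z) (fun z => r * sin z)).
- by apply: filterS near_disc => q /df[].
- by apply: filterS near_disc => q /df[].
- exact: part_cont p1 _ Dp.
- exact: part_cont p2 _ Dp.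
- by rewrite mul1r mulNr -mulrN; apply: is_derive_scale; exact: is_derive_cos.
- by rewrite mul1r addr0; apply: is_derive_scale; exact: is_derive_sin.
Qed.

End angular.

(** * The error estimate *)

Section assembly.
Context {R : realType}.
Implicit Types (rad r phi : R) (f : R * R -> R) (F G : R -> R -> R).

(** The first term is 1, but the partial sums bound their limit from below only once convergence is
    known. It follows from the telescoping bound 1 / (n (n + 1)) = 1 / n - 1 / (n + 1). *)
Lemma zeta_ge1 s : (2 <= s)%N -> 1 <= zeta s :> R.
Proof.
move=> s2; rewrite /zeta; set u := series _.
have t0 n : 0 <= 1 / n.+1%:R ^+ s :> R by rewrite divr_ge0 ?exprn_ge0.
have ndu : nondecreasing_seq u.
  by apply/nondecreasing_seqP => n; rewrite /u /series/= big_nat_recr//= lerDl.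
have ub n : u n.+1 <= 2 - n.+1%:R^-1.
  elim: n => [|n IH]; first by rewrite /u /series/= big_nat1 expr1n divr1 invr1; lra.
  rewrite /u /series/= big_nat_recr//=.
  have p1 : 0 < n.+1%:R :> R by rewrite ltr0n.
  have p2 : 0 < n.+2%:R :> R by rewrite ltr0n.
  have n1 : 1 <= n.+2%:R :> R by rewrite ler1n.
  have : 1 / n.+2%:R ^+ s <= n.+1%:R^-1 - n.+2%:R^-1 :> R.
    apply: (@le_trans _ _ (1 / (n.+1%:R * n.+2%:R))).
      rewrite !div1r lef_pV2 ?posrE ?mulr_gt0 ?exprn_gt0//.
      apply: (@le_trans _ _ (n.+2%:R ^+ 2)); last exact: ler_weXn2l.
      by rewrite expr2 ler_pM2r// ler_nat.
    rewrite (_ : n.+2%:R = n.+1%:R + 1) in p2 *; last by rewrite mulrSr.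
    rewrite le_eqVlt; apply/orP; left; apply/eqP.
    by field; rewrite !gt_eqF.
  by move=> h; apply: le_trans (lerD IH h) _; rewrite addrA subrK.
have cu : cvgn u.
  apply: nondecreasing_is_cvgn => //; exists 2 => _ [n _ <-].
  apply: le_trans (ndu _ _ (leqnSn n)) _; apply: le_trans (ub n) _.
  by rewrite gerBl invr_ge0.
have := nondecreasing_cvgn_le ndu cu 1%N.
by rewrite {1}/u /series/= big_nat1 expr1n divr1.
Qed.

(** Unfolds the nested existence of derivatives into one sequence indexed by the order. *)
Lemma angular_class_chain rad m F : angular_class rad m F ->
  exists g : nat -> R -> R -> R,
    [/\ g 0%N = F,
        forall i r phi, (i < m)%N -> 0 <= r < rad ->
          is_derive phi 1 (g i r) (g i.+1 r phi),
        forall r, 0 <= r < rad -> continuous (g m r) &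
        exists B, forall r phi, 0 <= r < rad -> `|g m r phi| <= B].
Proof.
elim: m F => [|m IH] F [bF cF hF]; first by exists (fun=> F); split.
have [F' F'm dF] := hF; have [g [g0 dg cg bg]] := IH F' F'm.
exists (fun i => if i is i'.+1 then g i' else F); split => //.
by case=> [|i] r phi im rr; [rewrite g0; exact: dF|exact: dg].
Qed.

Lemma derive1n_chain (g : nat -> R -> R) m :
  (forall i (x : R), (i < m)%N -> is_derive x 1 (g i) (g i.+1 x)) ->
  forall i, (i <= m)%N -> derive1n i (g 0%N) = g i.
Proof.
move=> dg; elim=> [//|i IH] im; apply: funext => x.
by rewrite derive1nS IH 1?ltnW// derive1E; case: (dg i x im).
Qed.

(** A real [sup] dominates the elements of a set only if the set is bounded above; [B] provides this
    for the inner and the outer supremum. *)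
Lemma angular_bound_ge rad m k l f (g : nat -> R -> R -> R) B : 0 < rad ->
  g 0%N = (fun r phi => f (polar r phi) * Y k l phi) ->
  (forall i r phi, (i < m)%N -> 0 <= r < rad ->
     is_derive phi 1 (g i r) (g i.+1 r phi)) ->
  (forall r phi, 0 <= r < rad -> `|g m r phi| <= B) ->
  forall r phi, 0 <= r < rad -> 0 <= phi <= 2 * pi ->
    `|g m r phi| <= angular_bound rad m k l f.
Proof.
move=> rad0 g0 dg bg r phi rr phipi.
pose A r := [set `|derive1n m (fun x : R => f (polar r x) * Y k l x) phi|
  | phi in `[0, 2 * pi]].
have AE r' : 0 <= r' < rad -> A r' = [set `|g m r' phi| | phi in `[0, 2 * pi]].
  move=> rr'; rewrite /A.
  have /(_ m (leqnn _)) := @derive1n_chain (fun i => g i r') m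
    (fun i x im => dg i r' x im rr').
  by rewrite g0 => ->.
have pi0 := @pi_gt0 R.
have Ane r' : A r' !=set0.
  exists `|derive1n m (fun x : R => f (polar r' x) * Y k l x) 0|.
  by exists 0 => //=; rewrite in_itv/= lexx; lra.
have ubA r' : 0 <= r' < rad -> ubound (A r') B.
  by move=> rr'; rewrite AE// => _ [x _ <-]; exact: bg.
(* The supremum over the boundary circle is a single number, whatever it is. *)
have hub : has_ubound [set sup (A r) | r in `[0, rad]].
  exists (Num.max B (sup (A rad))) => _ [r' + <-]; rewrite /= in_itv/= => /andP[r0 r1].
  rewrite le_max; have [rl|rl] := ltP r' rad.
    by rewrite ge_sup//; apply: ubA; rewrite r0.
  by rewrite (_ : r' = rad) ?lexx ?orbT//; apply/eqP; rewrite eq_le r1.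
apply: (@le_trans _ _ (sup (A r))).
  apply: ub_le_sup; first by exists B; exact: ubA.
  by rewrite AE//; exists phi => //=; rewrite in_itv.
by apply: (ub_le_sup hub); exists r => //=; rewrite in_itv/=; lra.
Qed.

Lemma Y_periodic k l phi : Y k l (phi + 2 * pi) = Y k l phi :> R.
Proof.
case: k => [//|k].
have E : k.+1%:R * (phi + 2 * pi) = k.+1%:R * phi + (pi *+ 2) *+ k.+1 :> R.
  by rewrite [2 * pi]mulr_natl mulrDr [_ * (pi *+ 2)]mulr_natl.
rewrite /Y E; case: ifP => _; congr (_ * _).
- exact: (periodicn (@cosD2pi R)).
- exact: (periodicn (@sinD2pi R)).
Qed.

Lemma polar_periodic r phi : polar r (phi + 2 * pi) = polar r phi.
Proof. by rewrite /polar [2 * _]mulr_natl cosD2pi sinD2pi. Qed.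

Lemma discrete_fourier_coef_error rad m M k l f r : 0 < rad -> (0 < M)%N ->
  partials_extend rad m.+1 f -> 0 <= r < rad ->
  `|fourier_coef f k l r - discrete_fourier_coef M f k l r| <=
    4 * pi * angular_bound rad m.+1 k l f / M%:R ^+ m.+1.
Proof.
move=> rad0 M0 hf rr; have pi0 := @pi_gt0 R.
have := angular_classM (angular_class_polar rad0 hf) (angular_class_Y rad m.+1 k l).
move=> /angular_class_chain[g [g0 dg cg [B bg]]].
have bd := angular_bound_ge rad0 g0 dg bg rr.
have c0 : continuous (g 0%N r).
  by move=> x; exact: is_derive_continuous (dg 0%N r x (ltn0Sn _) rr).
have [G dG] := primitive_exists (-1) c0.
have -> : fourier_coef f k l r = G (2 * pi) - G 0.
  have -> : fourier_coef f k l r =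
      \int[@lebesgue_measure R]_(x in `[0, 2 * pi]) g 0%N r x.
    by rewrite g0.
  by apply: Rintegral_primitive => //; [lra|move=> x ?; apply: dG; lra].
have -> : discrete_fourier_coef M f k l r =
    2 * pi / M%:R * \sum_(1 <= s < M.+1) g 0%N r (2 * pi * s%:R / M%:R).
  by rewrite g0.
apply: (@trapezoid_le R m M (fun i => g i r) G) => //.
- by move=> i x im; apply: dg.
- exact: cg.
- by move=> x; rewrite g0 polar_periodic Y_periodic.
Qed.

End assembly.

Theorem theorem6 (R : realType) (rad : R) (w : R * R -> R) (N M K D : nat)
    (t lambda : nat -> nat -> 'I_N -> R) (f : R * R -> R)
    (hrad : 0 < rad)
    (hw : weight_continuous rad w)
    (hwreg : weight_regular rad w)
    (hwpd : pseudo_definite rad w)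
    (hN : (1 <= N)%N) (hM : (1 <= M)%N) (hD : (1 <= D)%N)
    (hgauss : gauss_data rad w t lambda)
    (hf : Cm_cdisc rad (2 * D + 1) f) :
  `| I_poly_infty K t lambda f - I_poly M K t lambda f | <=
  2 * pi * zeta (2 * D + 1) / M%:R ^+ (2 * D + 1) *
  \sum_(0 <= k < K.+1) \sum_(1 <= l < (mult k).+1)
     angular_bound rad (2 * D + 1) k l f *
     (\int[@lebesgue_measure R]_(r in `]0, rad[)
        (`|fourier_coef w k l r| * r))%R.
Proof.
have pi0 := @pi_gt0 R.
have zeta1 : 1 <= zeta (2 * D + 1) :> R.
  by apply: zeta_ge1; rewrite addn1 ltnS muln_gt0.
move: hf zeta1; rewrite addn1; set m := (2 * D)%N => -[_ hf] zeta1.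
pose I k l := (\int[@lebesgue_measure R]_(r in `]0, rad[)
        (`|fourier_coef w k l r| * r)).
pose A k l := angular_bound rad m.+1 k l f.
have I0 k l : 0 <= I k l.
  apply: Rintegral_ge0 => r; rewrite /= in_itv/= => /andP[/ltW r0 _].
  exact: mulr_ge0.
have Mm : 0 < M%:R ^+ m.+1 :> R by rewrite exprn_gt0// ltr0n.
(* The error estimate at r = 0 places a positive multiple of [A k l] above an absolute value. *)
have A0 k l : 0 <= A k l.
  have r0 : 0 <= (0 : R) < rad by rewrite lexx.
  have := le_trans (normr_ge0 _) (discrete_fourier_coef_error k l hrad hM hf r0).
  by rewrite pmulr_lge0 ?invr_gt0// pmulr_rge0//; lra.
have W k l : valid_index k l ->
    \sum_(j < N) `|lambda k l j| * t k l j `^ (- (k%:R / 2)) <= I k l.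
  move=> v; have [hg1 hg0] := hgauss k l v; have [cw iw] := hwreg k l v.
  have [[r rr wr]|nw] := pselect (exists2 r, 0 < r < rad & fourier_coef w k l r != 0).
    have [tb _ sl mom] := hg1 (ex_intro2 _ _ r rr wr).
    exact: gauss_weight_le cw (hwpd k l v) iw tb sl mom.
  (* An identically zero coefficient of w comes with zero weights, so the sum vanishes. *)
  rewrite big1 ?I0// => j _; have [|_ ->] := hg0 _ j; last by rewrite normr0 mul0r.
  by move=> r rr; apply/eqP; apply: contra_notT nw => wr; exists r.
have tb k l j : valid_index k l -> 0 < t k l j < rad ^+ 2.
  move=> v; have [hg1 hg0] := hgauss k l v.
  have [[r rr wr]|nw] := pselect (exists2 r, 0 < r < rad & fourier_coef w k l r != 0).
    by have [] := hg1 (ex_intro2 _ _ r rr wr).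
  have [|//] := hg0 _ j.
  by move=> r rr; apply/eqP; apply: contra_notT nw => wr; exists r.
(* The constant of the angular error. The factor 1 / 2 of the cubature sum will reduce 4 pi to 2
   pi. *)
pose C := 4 * pi / M%:R ^+ m.+1 : R.
have C0 : 0 <= C by rewrite /C divr_ge0 ?(ltW Mm)//; lra.
apply: (@le_trans _ _ (1 / 2 * \sum_(0 <= k < K.+1) \sum_(1 <= l < (mult k).+1)
    (C * (A k l * I k l)))).
  rewrite /I_poly_infty /I_poly /cubature_sum -mulrBr normrM ger0_norm//.
  apply: ler_wpM2l => //; rewrite -sumrB; apply: le_trans (ler_norm_sum _ _ _) _.
  apply: ler_sum_nat => k _; rewrite -sumrB; apply: le_trans (ler_norm_sum _ _ _) _.
  apply: ler_sum_nat => l hl; have v : valid_index k l by rewrite /valid_index -ltnS.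
  rewrite -sumrB; apply: le_trans (ler_norm_sum _ _ _) _.
  apply: (@le_trans _ _ (\sum_(j < N) C * A k l *
      (`|lambda k l j| * t k l j `^ (- (k%:R / 2))))).
    apply: ler_sum => j _; rewrite -mulrBr !normrM (ger0_norm (powR_ge0 _ _)) mulrC.
    apply: ler_wpM2r; first by rewrite mulr_ge0// powR_ge0.
    rewrite /C mulrAC.
    apply: discrete_fourier_coef_error => //.
    (* The nodes lie strictly between 0 and [rad ^+ 2], so their radii are interior, as the angular
       estimate requires. *)
    have /andP[h1 h2] := sqrt_lt_sqr hrad (tb k l j v).
    by rewrite (ltW h1).
  rewrite -mulr_sumr mulrA; apply: ler_wpM2l; last exact: W.
  exact: mulr_ge0.
rewrite (_ : \sum_(0 <= k < K.+1) _ = C * \sum_(0 <= k < K.+1)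
    \sum_(1 <= l < (mult k).+1) (A k l * I k l)); last first.
  by rewrite mulr_sumr; apply: eq_bigr => k _; rewrite mulr_sumr.
rewrite mulrA; apply: ler_wpM2r.
  by rewrite sumr_ge0// => k _; rewrite sumr_ge0// => l _; rewrite mulr_ge0.
rewrite /C mulrA ler_pM2r ?invr_gt0//.
(* The bound obtained so far has constant 2 pi; since zeta is at least 1, inserting it only enlarges
   the right side. *)
have : 0 <= 2 * pi * (zeta m.+1 - 1) :> R by rewrite mulr_ge0//; lra.
lra.
Qed.
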